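(* Suppose $\alpha>-1$ is real and $N\in\mathbb{N}$. Then the following hold. (i) $\Lambda_{\alpha,N}^{N}f\in C_\infty(W_{\ge}^N)$ for any $f\in C_\infty(W_{\ge}^N)$. (ii) $\Lambda_{\alpha,N}^{N+1}f\in C_\infty(W_{\ge}^{N+1})$ for any $f\in C_\infty(W_{\ge}^N)$.
   Context: $W_{\ge}^N=\{\mathbf{x}\in[0,\infty)^N: x_1\le\dots\le x_N\}$, $\mathring{W}_{\ge}^N=\{\mathbf{x}\in W_{\ge}^N: 0<x_1<\dots<x_N\}$. $C_\infty(E)$ is the set of continuous real functions on $E$ vanishing at infinity. $\Delta_N(\mathbf{y})=\prod_{1\le i<j\le N}(y_j-y_i)$ and $(x)_n=x(x+1)\cdots(x+n-1)$. Kernels act on functions by $(\Lambda f)(x)=\int\Lambda(x,dy)f(y)$. For $\mathbf{z}\in W_{\ge}^N$ let $W_{\ge}^{N,N}(\mathbf{z})=\{\mathbf{y}\in W_{\ge}^N: 0\le y_1\le z_1\le y_2\le\dots\le y_N\le z_N\}$. For $\mathbf{z}\in\mathring{W}_{\ge}^N$, $$\Lambda_{\alpha,N}^{N}(\mathbf{z},d\mathbf{y})=(\alpha+1)_N\bigg(\prod_{k=1}^N\frac{y_k^\alpha}{z_k^{\alpha+1}}\bigg)\frac{\Delta_N(\mathbf{y})}{\Delta_N(\mathbf{z})}\mathbf{1}_{W_{\ge}^{N,N}(\mathbf{z})}(\mathbf{y})\,d\mathbf{y}.$$ For $\mathbf{x}\in\mathring{W}_{\ge}^{N+1}$, $$\Lambda_{\alpha,N}^{N+1}(\mathbf{x},d\mathbf{y})=N!\,(\alpha+1)_N\frac{\Delta_N(\mathbf{y})}{\Delta_{N+1}(\mathbf{x})}\prod_{k=1}^N\bigg(\mathbf{1}_{[x_{k-1},x_{k+1}]}(y_k)\int_{x_k\vee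 y_k}^{x_{k+1}\wedge y_{k+1}}\frac{y_k^\alpha}{z^{\alpha+1}}\,dz\bigg)d\mathbf{y},$$ a measure on $W_{\ge}^N$, with the conventions $x_0=0$ and $y_{N+1}=\infty$. At the remaining points of $W_{\ge}^N$ (respectively $W_{\ge}^{N+1}$) the measures $\Lambda_{\alpha,N}^N(\mathbf{z},\cdot)$ (respectively $\Lambda_{\alpha,N}^{N+1}(\mathbf{x},\cdot)$) are defined as the weak limits along any sequence in $\mathring{W}_{\ge}^N$ (respectively $\mathring{W}_{\ge}^{N+1}$) converging to the point (the limits exist and do not depend on the sequence). *)

(* Defs.v *)
From HB Require Import structures.
From mathcomp Require Import all_boot all_order all_algebra.
From mathcomp Require Import all_classical all_reals all_analysis.

Set Implicit Arguments.
Unset Strict Implicit.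
Unset Printing Implicit Defensive.

Import Order.TTheory GRing.Theory Num.Theory.
Import numFieldNormedType.Exports.

Local Open Scope classical_set_scope.
Local Open Scope ring_scope.

(* Points of R^n are row vectors, which carry the topology. Measures on R^n
   live on n-tuples, which carry the product sigma-algebra of the Borel
   sigma-algebras, i.e. the Borel sigma-algebra of R^n. *)
Notation Rtuple R n := (n.-tuple (measurableTypeR R)).

Definition vec (R : realType) (n : nat) (t : Rtuple R n) : 'rV[R]_n :=
  \row_i (tnth t i : R).

Section lebesgue_measure_on_tuples.
Context (R : realType) (n : nat).

Definition cons_pair (p : Rtuple R n * measurableTypeR R) : Rtuple R n.+1 :=
  [tuple of p.2 :: p.1].

Lemma measurable_cons_pair : measurable_fun [set: _] cons_pair.
Proof. exact: measurable_cons. Qed.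

Context (m : {measure set (Rtuple R n) -> \bar R}).

Definition leb_cons : set (Rtuple R n.+1) -> \bar R :=
  pushforward (m \x (@lebesgue_measure R))%E cons_pair.

Let leb_cons0 : leb_cons set0 = 0%E.
Proof. by rewrite /leb_cons /pushforward preimage_set0 measure0. Qed.

Let leb_cons_ge0 A : (0 <= leb_cons A)%E.
Proof. by rewrite /leb_cons /pushforward measure_ge0. Qed.

Let leb_cons_sigma_additive : semi_sigma_additive leb_cons.
Proof.
move=> F mF tF mUF; rewrite /leb_cons /pushforward preimage_bigcup.
apply: measure_semi_sigma_additive.
- by move=> k; rewrite -[X in measurable X]setTI; exact: measurable_cons_pair.
- apply/trivIsetP => /= i j _ _ ij; rewrite -preimage_setI.
  by move/trivIsetP : tF => /(_ _ _ _ _ ij) ->//; rewrite preimage_set0.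
- by rewrite -preimage_bigcup -[X in measurable X]setTI;
    exact: measurable_cons_pair.
Qed.

HB.instance Definition _ := isMeasure.Build _ _ _ leb_cons
  leb_cons0 leb_cons_ge0 leb_cons_sigma_additive.

End lebesgue_measure_on_tuples.

(* Lebesgue measure on R^n, see leb_box. *)
Fixpoint leb (R : realType) (n : nat) : {measure set (Rtuple R n) -> \bar R} :=
  match n with
  | 0 => \d_([tuple] : Rtuple R 0)
  | k.+1 => leb_cons (leb R k)
  end.

Lemma measurable_box (R : realType) (n : nat)
    (A : 'I_n -> set (measurableTypeR R)) : (forall i, measurable (A i)) ->
  measurable [set t : Rtuple R n | forall i, A i (tnth t i)].
Proof.
move=> mA; rewrite (_ : mkset _ = \bigcap_(i in [set: 'I_n])
    ((fun t : Rtuple R n => tnth t i) @^-1` A i)); last first.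
  by apply/seteqP; split=> t /= h i; [move=> _; exact: h|exact: h].
apply: fin_bigcap_measurable => [|i _]; first exact: finite_finset.
by rewrite -[X in measurable X]setTI; apply: measurable_tnth => //; exact: mA.
Qed.

Lemma leb_box (R : realType) (n : nat)
    (A : 'I_n -> set (measurableTypeR R)) : (forall i, measurable (A i)) ->
  leb R n [set t | forall i, A i (tnth t i)] =
  (\prod_(i < n) @lebesgue_measure R (A i))%E.
Proof.
elim: n A => [|n IH] A mA /=.
  by rewrite big_ord0 diracE mem_set// => -[].
rewrite big_ord_recl /leb_cons /pushforward.
rewrite (_ : _ @^-1` _ =
    [set t : Rtuple R n | forall i, A (lift ord0 i) (tnth t i)] `*` A ord0).
  rewrite product_measure1E//; last exact: (@measurable_box R n (fun i => A (lift ord0 i)) (fun i => mA _)).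
  by rewrite (IH (fun i => A (lift ord0 i)))// muleC.
apply/seteqP; split=> -[t x] /=.
  move=> h; split; last by have := h ord0.
  by move=> i; have := h (lift ord0 i); rewrite tnthS.
move=> [h1 h2] i; have [j ->|->] := unliftP ord0 i; last by [].
by rewrite tnthS; exact: h1.
Qed.

Definition W (R : realType) (n : nat) : set 'rV[R]_n :=
  [set x | (forall i, 0 <= x ord0 i) /\
           (forall i j : 'I_n, (i <= j)%N -> x ord0 i <= x ord0 j)].

Definition Wint (R : realType) (n : nat) : set 'rV[R]_n :=
  [set x | (forall i, 0 < x ord0 i) /\
           (forall i j : 'I_n, (i < j)%N -> x ord0 i < x ord0 j)].

Definition C_infty (R : realType) (n : nat) (E : set 'rV[R]_n)
    (f : 'rV[R]_n -> R) : Prop :=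
  {within E, continuous f} /\
  forall e : R, 0 < e -> exists K : set 'rV[R]_n,
    [/\ compact K, K `<=` E & forall x, E x -> ~ K x -> `|f x| < e].

(* One-based coordinates x_1, ..., x_n, with x_0 = 0; the value for an index
   larger than n is irrelevant. *)
Definition coord (R : realType) (n : nat) (x : 'rV[R]_n) (k : nat) : R :=
  if k is j.+1 then oapp (x ord0) 0 (insub j : option 'I_n) else 0.

Definition vandermonde (R : realType) (n : nat) (x : 'rV[R]_n) : R :=
  \prod_(i < n) \prod_(j < n | (i < j)%N) (x ord0 j - x ord0 i).

Definition poch (R : realType) (a : R) (n : nat) : R :=
  \prod_(0 <= k < n) (a + k%:R).

Definition interlacing (R : realType) (n : nat) (z : 'rV[R]_n) : set 'rV[R]_n :=
  [set y | W y /\ forall k, (1 <= k <= n)%N ->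
     coord z k.-1 <= coord y k <= coord z k].

Definition density_NN (R : realType) (alpha : R) (n : nat)
    (z y : 'rV[R]_n) : R :=
  poch (alpha + 1) n *
  (\prod_(1 <= k < n.+1) (coord y k `^ alpha / coord z k `^ (alpha + 1))) *
  (vandermonde y / vandermonde z) * \1_(interlacing z) y.

(* x_{k+1} /\ y_{k+1} with y_{n+1} = +oo *)
Definition upper_end (R : realType) (n : nat) (x : 'rV[R]_n.+1) (y : 'rV[R]_n)
    (k : nat) : R :=
  if (k < n)%N then Num.min (coord x k.+1) (coord y k.+1) else coord x k.+1.

Definition density_SN (R : realType) (alpha : R) (n : nat)
    (x : 'rV[R]_n.+1) (y : 'rV[R]_n) : R :=
  n`!%:R * poch (alpha + 1) n * (vandermonde y / vandermonde x) *
  \prod_(1 <= k < n.+1)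
    (\1_(`[coord x k.-1, coord x k.+1]) (coord y k) *
     \int[@lebesgue_measure R]_(z in
         `[Num.max (coord x k) (coord y k), upper_end x y k])
       (coord y k `^ alpha / z `^ (alpha + 1))).

(* [weak_extension dens L]: on W_m the family of measures L on W_n is given
   by the density dens at the points of the interior of W_m and, at the
   remaining points, is the weak limit along any sequence of interior points.
   Integrating bounded continuous functions on W_n separates finite measures,
   so L is determined on all of W_m; its values outside W_m are irrelevant. *)
Definition weak_extension (R : realType) (m n : nat)
    (dens : 'rV[R]_m -> 'rV[R]_n -> R)
    (L : 'rV[R]_m -> {measure set (Rtuple R n) -> \bar R}) : Prop :=
  (forall x, Wint x -> forall A : set (Rtuple R n), measurable A ->
     L x A = \int[leb R n]_(t in A `&` (@vec R n @^-1` @W R n))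
               (dens x (vec t))%:E)%E /\
  (forall x, W x -> ~ Wint x ->
     L x (~` (@vec R n @^-1` @W R n)) = 0%E /\
     forall u : nat -> 'rV[R]_m, (forall k, Wint (u k)) -> u @ \oo --> x ->
     forall g : 'rV[R]_n -> R, {within @W R n, continuous g} ->
       [bounded g y | y in @W R n] ->
       (\int[L (u k)]_(t in @vec R n @^-1` @W R n) (g (vec t))%:E)%E
         @[k --> \oo] -->
       (\int[L x]_(t in @vec R n @^-1` @W R n) (g (vec t))%:E)%E).

Definition is_Lambda_NN (R : realType) (alpha : R) (n : nat)
    (L : 'rV[R]_n -> {measure set (Rtuple R n) -> \bar R}) : Prop :=
  weak_extension (@density_NN R alpha n) L.

Definition is_Lambda_SN (R : realType) (alpha : R) (n : nat)
    (L : 'rV[R]_n.+1 -> {measure set (Rtuple R n) -> \bar R}) : Prop :=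
  weak_extension (@density_SN R alpha n) L.

Definition kernel_op (R : realType) (m n : nat)
    (L : 'rV[R]_m -> {measure set (Rtuple R n) -> \bar R})
    (f : 'rV[R]_n -> R) (x : 'rV[R]_m) : R :=
  \int[L x]_(t in @vec R n @^-1` @W R n) f (vec t).

(* Main.v *)
Require Import Defs.
From HB Require Import structures.
From mathcomp Require Import all_boot all_order all_algebra.
From mathcomp Require Import all_classical all_reals all_analysis.
From mathcomp Require Import perm measurable_realfun ring lra.

Set Implicit Arguments.
Unset Strict Implicit.
Unset Printing Implicit Defensive.

Import Order.TTheory GRing.Theory Num.Theory.
Import numFieldNormedType.Exports.

Local Open Scope classical_set_scope.
Local Open Scope ring_scope.

(** Why the theorem holds.

    At interior points both kernels are, up to normalisation, integrals over a
    product of intervals [p_i, p_(i+1)] of a weight prod_i t_i^a times the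
    Vandermonde product of t ([weight], [cell_integral]).

    Equal dimensions. The nodes are 0, z_1, ..., z_N. The weight times
    prod_i (1 + c t_i)^-(a+N+1) becomes, in the variables t / (1 + c t), a
    determinant of functions of one variable each; integrating entry by entry
    gives another Vandermonde determinant, and altogether the kernel maps
      prod_i (1 + c t_i)^-(a+N+1)   to   prod_i (1 + c z_i)^-(a+N)
    exactly ([integral_weight_decay_NN]). At c = 0 this is the normalisation. At
    c = 1 the left side is positive and continuous, so any f vanishing at infinity
    satisfies |f| <= e + C prod_i (1 + t_i)^-(a+N+1), and the right side tends to 0
    as z goes to infinity: the image of f vanishes at infinity.

    From N + 1 to N. The inner integrals of the density run over the coordinates
    of a point s with x_k <= s_k <= x_(k+1), and writing the kernel as a double
    integral over s and t shows that it is the kernel of equal dimensions followed,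
    in the variable s, by the kernel with density N! Delta(s) / Delta(x) on the
    product of the intervals [x_k, x_(k+1)] ([integral_SN]). The latter is again a
    normalised cell integral, with a = 0 and nodes x_1, ..., x_(N+1), and maps
    prod_i (1 + c s_i)^-(N+1) to prod_i (1 + c x_i)^-N
    ([integral_weight_decay_SN]). The same argument, applied to the image of f
    under the first kernel, gives the second assertion.

    Continuity. At interior points the cell integrals depend continuously on
    their nodes by dominated convergence ([cvg_cell_integral]). At the remaining
    points convergence along interior sequences is the definition of the kernels,
    and it extends to all sequences of W because interior points are dense
    ([continuous_W_of_Wint]). *)

(* The name is otherwise taken by the coordinates in a basis of a vector space. *)
Local Notation coord := Defs.coord.

(** * Integration over tuples *)

Section tuple_integral.
Context {R : realType}.
Local Open Scope ereal_scope.
Local Notation mu := (@lebesgue_measure R).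

Lemma leb_sigma_finite n : sigma_finite [set: Rtuple R n] (leb R n).
Proof.
pose F (k : nat) : set (Rtuple R n) :=
  [set t | forall i, (fun _ : 'I_n => `[(- k%:R)%R, k%:R]%classic) i (tnth t i)].
exists F.
  apply/seteqP; split => // t _.
  pose M := (\sum_(i < n) `|tnth t i : R|)%R.
  exists (Num.truncn M).+1 => // i /=.
  have hM : (`|tnth t i : R| <= M)%R.
    by rewrite /M (bigD1 i)//= lerDl sumr_ge0.
  have := truncnS_gt M => hM2.
  rewrite in_itv/= -ler_norml; apply: (le_trans hM); exact: ltW.
move=> k; split.
  by apply: (@measurable_box R n (fun _ => `[(- k%:R)%R, k%:R]%classic)) => i; exact: measurable_itv.
rewrite (@leb_box R n (fun _ => `[(- k%:R)%R, k%:R]%classic)).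
  suff /andP[] : (0 <= \prod_(i < n) mu `[(- k%:R)%R, k%:R]%classic < +oo) by [].
  elim/big_ind: _.
  - by rewrite ltry lee_fin ler01.
  - move=> x y /andP[x1 x2] /andP[y1 y2]; rewrite mule_ge0//=.
    by rewrite lte_mul_pinfty// ge0_fin_numE.
  - move=> i _; rewrite measure_ge0/= lebesgue_measure_itv/=.
    by case: ifP => _; rewrite ?ltry// -EFinB ltry.
by move=> i; exact: measurable_itv.
Qed.

(** The same measure, under a name that carries its sigma-finiteness: both
    iterated integrals of Fubini's theorem over pairs of tuples need it. *)
Definition leb_sigma n : set (Rtuple R n) -> \bar R := leb R n.
HB.instance Definition _ n := Measure.copy (@leb_sigma n) (leb R n).
HB.instance Definition _ n :=
  Measure_isSigmaFinite.Build _ _ _ (@leb_sigma n) (@leb_sigma_finite n).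

Lemma ge0_integral_leb_cons n (f : Rtuple R n.+1 -> \bar R) :
  measurable_fun [set: Rtuple R n.+1] f -> (forall t, 0 <= f t) ->
  \int[leb R n.+1]_t f t = \int[leb R n]_t \int[mu]_x f [tuple of x :: t].
Proof.
move=> mf f0.
have mc := @measurable_cons_pair R n.
transitivity (\int[pushforward (leb R n \x mu) (@cons_pair R n)]_t f t).
  exact: eq_measure_integral.
rewrite ge0_integral_pushforward//.
rewrite preimage_setT.
rewrite (@fubini_tonelli1 _ _ _ _ _ (@leb_sigma n) mu (f \o @cons_pair R n))//.
  exact: measurableT_comp.
by move=> x; exact: f0.
Qed.

Lemma measurable_coords_prod n (h : 'I_n -> R -> R) :
  (forall i, measurable_fun setT (h i)) ->
  measurable_fun [set: Rtuple R n] (fun t => (\prod_(i < n) h i (tnth t i))%R).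
Proof.
move=> mh; apply: measurable_prod => i _.
by apply: (measurableT_comp (mh i)); exact: measurable_tnth.
Qed.

Lemma ge0_integral_leb_prod n (h : 'I_n -> R -> R) :
  (forall i, measurable_fun setT (h i)) -> (forall i x, (0 <= h i x)%R) ->
  \int[leb R n]_t (\prod_(i < n) h i (tnth t i))%:E =
  \prod_(i < n) \int[mu]_x (h i x)%:E.
Proof.
elim: n h => [|n IH] h mh h0.
  under eq_integral do rewrite big_ord0.
  by rewrite integral_cst//= big_ord0 mul1e diracT.
rewrite ge0_integral_leb_cons; last 2 first.
- by apply/measurable_EFinP; exact: measurable_coords_prod.
- by move=> t; rewrite lee_fin prodr_ge0.
transitivity (\int[leb R n]_t (\int[mu]_x (h ord0 x)%:E *
    (\prod_(i < n) h (lift ord0 i) (tnth t i))%:E)).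
  apply: eq_integral => t _.
  rewrite muleC -ge0_integralZl//.
  - apply: eq_integral => x _; rewrite big_ord_recl/= tnth0 mulrC EFinM.
    by congr (_%:E * _); apply: eq_bigr => i _; rewrite tnthS.
  - by apply/measurable_EFinP; exact: mh.
  - by move=> x _; rewrite lee_fin.
  - by rewrite lee_fin prodr_ge0.
rewrite ge0_integralZl//.
- by rewrite big_ord_recl (IH (fun i => h (lift ord0 i))).
- apply/measurable_EFinP; exact: (measurable_coords_prod (fun i => mh (lift ord0 i))).
- by move=> t _; rewrite lee_fin prodr_ge0.
- by apply: integral_ge0 => x _; rewrite lee_fin.
Qed.

Import HBNNSimple.

(** It holds for indicators by definition of the density, hence for simple
    functions, hence in general by monotone convergence. *)
Lemma ge0_integral_density d (T : measurableType d) (m v : {measure set T -> \bar R})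
    (D : set T) (k f : T -> R) :
  measurable D -> measurable_fun D k -> (forall x, D x -> 0 <= k x)%R ->
  (forall A, measurable A -> v A = \int[m]_(x in A `&` D) (k x)%:E) ->
  measurable_fun D f -> (forall x, D x -> 0 <= f x)%R ->
  \int[v]_(x in D) (f x)%:E = \int[m]_(x in D) (f x * k x)%:E.
Proof.
move=> mD mk k0 vE mf f0.
have mEf : measurable_fun D (EFin \o f) by exact/measurable_EFinP.
have f0' x : D x -> 0 <= (EFin \o f) x by move=> Dx; rewrite lee_fin f0.
pose g := nnsfun_approx mD mEf.
have gf x : D x -> EFin \o g ^~ x @ \oo --> (f x)%:E.
  by move=> Dx; exact: (cvg_nnsfun_approx mD mEf f0').
transitivity (limn (fun n => \int[v]_(x in D) (g n x)%:E)).
  rewrite -monotone_convergence//.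
  - by apply: eq_integral => x /[!inE] Dx; apply/esym/cvg_lim => //; exact: gf.
  - by move=> n; exact/measurable_EFinP/measurable_funP.
  - by move=> n x _; rewrite lee_fin.
  - by move=> x _ a b ab; rewrite lee_fin; exact/lefP/nd_nnsfun_approx.
transitivity (limn (fun n => \int[m]_(x in D) ((g n x)%:E * (k x)%:E))); last first.
  rewrite -monotone_convergence//; last 3 first.
  - move=> n; apply: emeasurable_funM; last exact/measurable_EFinP.
    by exact/measurable_EFinP/measurable_funP.
  - by move=> n x Dx; rewrite mule_ge0// lee_fin// k0.
  - move=> x Dx a b ab; rewrite lee_wpmul2r// ?lee_fin ?k0//.
    exact/lefP/nd_nnsfun_approx.
  apply: eq_integral => x /[!inE] Dx; apply/cvg_lim => //.
  by rewrite EFinM; apply: cvgeMr => //; exact: gf.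
congr (limn _); apply/funext => n.
transitivity (\sum_(r \in range (g n)) \int[v]_(x in D) (r * \1_(g n @^-1` [set r]) x)%:E).
  under eq_integral do rewrite fimfunE -fsumEFin//.
  rewrite ge0_integral_fsum//.
  - by move=> y; exact/measurable_EFinP/measurable_funM.
  - by move=> y x _; rewrite nnfun_muleindic_ge0.
transitivity (\sum_(r \in range (g n))
   \int[m]_(x in D) ((r * \1_(g n @^-1` [set r]) x)%:E * (k x)%:E)); last first.
  rewrite -ge0_integral_fsum//; last 2 first.
  - move=> y; apply: emeasurable_funM; last exact/measurable_EFinP.
    exact/measurable_EFinP/measurable_funM.
  - by move=> y x Dx; rewrite mule_ge0// ?nnfun_muleindic_ge0// lee_fin k0.
  apply: eq_integral => x _.
  rewrite -ge0_mule_fsuml; last by move=> r; rewrite nnfun_muleindic_ge0.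
  by rewrite [in RHS]fimfunE -fsumEFin.
apply: eq_fsbigr => r /[!inE] -[x0 _ gr].
have r0 : (0 <= r)%R by rewrite -gr.
have mA : measurable (g n @^-1` [set r]) by exact: measurable_funPTI.
under eq_integral do rewrite EFinM.
rewrite ge0_integralZl//; last by exact/measurable_EFinP.
rewrite integral_indic// vE; last exact: measurableI.
under [RHS]eq_integral do rewrite EFinM -muleA.
rewrite ge0_integralZl//; last 2 first.
- by apply: emeasurable_funM; exact/measurable_EFinP.
- by move=> x Dx; rewrite mule_ge0// lee_fin k0.
congr (_ * _); rewrite -setIA setIid setIC integral_mkcondr; apply: eq_integral => x _.
by rewrite epatch_indic muleC.
Qed.

End tuple_integral.

(** * A family of changes of variables *)

Section moebius.
Context {R : realType}.
Implicit Types c x y b : R.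

(** For c = 0 this is the identity and for c > 0 it maps [0, +oo[ onto
    [0, 1/c[; both cases are computed at once by keeping c a parameter. *)
Definition moebius c y := y / (1 + c * y).

Lemma moebius_den_gt0 c y : 0 <= c -> 0 <= y -> 0 < 1 + c * y.
Proof. by move=> c0 y0; rewrite ltr_pwDl// mulr_ge0. Qed.

Lemma moebius_ge0 c y : 0 <= c -> 0 <= y -> 0 <= moebius c y.
Proof. by move=> c0 y0; rewrite divr_ge0// ltW// moebius_den_gt0. Qed.

Lemma moebius_gt0 c y : 0 <= c -> 0 < y -> 0 < moebius c y.
Proof. by move=> c0 y0; rewrite divr_gt0// moebius_den_gt0// ltW. Qed.

Lemma moebius_le c y : 0 <= c -> 0 <= y -> moebius c y <= y.
Proof.
move=> c0 y0; rewrite ler_pdivrMr ?moebius_den_gt0// ler_peMr// lerDl.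
exact: mulr_ge0.
Qed.

(** Differences are multiplied by a product of one-variable factors, which is
    what makes Vandermonde determinants covariant under these maps. *)
Lemma moebiusB c x y : 0 <= c -> 0 <= x -> 0 <= y ->
  moebius c y - moebius c x = (y - x) / ((1 + c * x) * (1 + c * y)).
Proof.
move=> c0 x0 y0; rewrite /moebius.
have := lt0r_neq0 (moebius_den_gt0 c0 x0).
have := lt0r_neq0 (moebius_den_gt0 c0 y0).
by move=> h1 h2; field; rewrite h1 h2.
Qed.

Lemma is_derive_moebius c y : 0 <= c -> 0 < y ->
  is_derive y 1 (moebius c) ((1 + c * y) ^- 2).
Proof.
move=> c0 y0; have d0 := lt0r_neq0 (moebius_den_gt0 c0 (ltW y0)).
have h : is_derive y (1 : R) (fun y => 1 + c * y) c.
  by apply: is_derive_eq; rewrite add0r scaler1/= ?mulr1 ?addr0//; ring.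
have := @is_deriveV _ _ y c 1 d0 h => h'.
rewrite /moebius; apply: is_derive_eq.
by rewrite /GRing.scale/=; field.
Qed.

Lemma is_derive_moebius_powR c y b : 0 <= c -> 0 < y ->
  is_derive y 1 (fun y => moebius c y `^ b)
    (b * moebius c y `^ (b - 1) * (1 + c * y) ^- 2).
Proof.
move=> c0 y0.
apply: (@is_derive1_comp _ (fun x => x `^ b) (moebius c)).
  exact/is_derive1_powR/moebius_gt0.
exact: is_derive_moebius.
Qed.

(** The derivative of [moebius c] at y is [(1 + c * y) ^- 2], so this is the
    density of a power function in the variable [moebius c y]. *)
Definition moebius_density c b y := moebius c y `^ b / (1 + c * y) ^+ 2.

Lemma continuous_moebius_density c b y : 0 <= c -> 0 < y ->
  {for y, continuous (moebius_density c b)}.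
Proof.
move=> c0 y0; have d0 := lt0r_neq0 (moebius_den_gt0 c0 (ltW y0)).
apply: cvgM.
  have h := @is_derive_moebius_powR c y b c0 y0.
  have : derivable (fun y => moebius c y `^ b) y 1 by exact: ex_derive.
  by move=> /derivable1_diffP/differentiable_continuous.
apply: cvgV; first by rewrite expf_neq0.
rewrite /=. under eq_fun do rewrite expr2. rewrite expr2.
apply: cvgM; (apply: cvgD; [exact: cvg_cst|apply: cvgM; [exact: cvg_cst|exact: cvg_id]]).
Qed.

Local Notation mu := (@lebesgue_measure R).

Lemma measurable_inv : measurable_fun [set: R] (fun x : R => x^-1).
Proof.
rewrite -(setUv [set (0 : R)]); apply/measurable_funU => //.
  exact: measurableC.
split; first exact: measurable_fun_set1.
apply: open_continuous_measurable_fun; first exact: closed_openC.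
by move=> x /[!inE]/= /eqP x0; exact: inv_continuous.
Qed.

Lemma measurable_moebius_den c : measurable_fun [set: R] (fun y => 1 + c * y).
Proof. by apply: measurable_funD => //; exact: measurable_funM. Qed.

Lemma measurable_moebius c : measurable_fun [set: R] (moebius c).
Proof.
apply: measurable_funM => //.
exact: (measurableT_comp measurable_inv (measurable_moebius_den c)).
Qed.

Lemma measurable_moebius_density c b : measurable_fun [set: R] (moebius_density c b).
Proof.
apply: measurable_funM.
  exact: (measurableT_comp (measurable_powR _) (measurable_moebius c)).
apply: (measurableT_comp measurable_inv).
exact: (measurable_funX _ (measurable_moebius_den c)).
Qed.

Lemma moebius_density_ge0 c b y : 0 <= moebius_density c b y.
Proof. by rewrite divr_ge0 ?powR_ge0// sqr_ge0. Qed.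

Let integral_pos c b x y : -1 < b -> 0 <= c -> 0 < x -> x <= y ->
  (\int[mu]_(t in `[x, y]) (moebius_density c b t)%:E =
  ((moebius c y `^ (b + 1) - moebius c x `^ (b + 1)) / (b + 1))%:E)%E.
Proof.
move=> b1 c0 x0; rewrite le_eqVlt => /predU1P[<-|xy].
  by rewrite set_itv1 integral_set1 subrr mul0r.
have b0 : b + 1 != 0 by rewrite lt0r_neq0//; lra.
pose F t : R := (b + 1)^-1 * moebius c t `^ (b + 1).
have dF (t : R) : 0 < t -> is_derive t (1 : R) F (moebius_density c b t).
  move=> t0; have := @is_derive_moebius_powR c t (b + 1) c0 t0 => h.
  apply: is_derive_eq.
  by rewrite /GRing.scale/= /moebius_density addrK -!mulrA mulKf.
have cF (t : R) : 0 < t -> {for t, continuous F}.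
  move=> t0; have ? := dF _ t0.
  have : derivable F t 1 by exact: ex_derive.
  by move=> /derivable1_diffP/differentiable_continuous.
rewrite (@continuous_FTC2 _ (moebius_density c b) F)//.
- by rewrite -EFinB /F; congr (_%:E); field.
- apply: continuous_in_subspaceT => t /[!inE]/=; rewrite in_itv/= => /andP[xt _].
  by apply: continuous_moebius_density => //; exact: lt_le_trans xt.
- split.
  + move=> t; rewrite in_itv/= => /andP[xt _].
    by have ? := dF _ (lt_trans x0 xt); exact: ex_derive.
  + by apply: cvg_at_right_filter; exact: cF.
  + by apply: cvg_at_left_filter; apply: cF; exact: lt_trans xy.
- move=> t; rewrite in_itv/= => /andP[xt _].
  by have ? := dF _ (lt_trans x0 xt); rewrite derive1E derive_val.
Qed.

(** Away from 0 this is the fundamental theorem of calculus. For b < 0 the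
    integrand is singular at 0, and the left end point 0 is reached by monotone
    convergence along the intervals [y / (n + 1), y]. *)
Lemma integral_moebius_density c b x y : -1 < b -> 0 <= c -> 0 <= x -> x <= y ->
  (\int[mu]_(t in `[x, y]) (moebius_density c b t)%:E =
  ((moebius c y `^ (b + 1) - moebius c x `^ (b + 1)) / (b + 1))%:E)%E.
Proof.
move=> b1 c0; rewrite le_eqVlt => /predU1P[<-|x0]; last exact: integral_pos.
rewrite le_eqVlt => /predU1P[<-|y0].
  by rewrite set_itv1 integral_set1 subrr mul0r.
have b0 : b + 1 != 0 by rewrite lt0r_neq0//; lra.
have M0 : moebius c 0 `^ (b + 1) = 0 by rewrite /moebius mul0r powR0.
rewrite M0 subr0.
pose u n : R := y / n.+1%:R.
have u0 n : 0 < u n by rewrite divr_gt0.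
have uy n : u n <= y by rewrite ler_pdivrMr// ler_peMr ?ler1n// ltW.
have und m n : (m <= n)%N -> u n <= u m.
  by move=> mn; rewrite ler_pM2l// lef_pV2 ?posrE// ler_nat.
have cu : u @ \oo --> 0.
  rewrite -[0 in X in _ --> X](mulr0 y); apply: cvgM; first exact: cvg_cst.
  exact: cvg_harmonic.
rewrite -integral_itv_obnd_cbnd//; last first.
  by apply/measurable_EFinP/measurable_funTS; exact: measurable_moebius_density.
have -> : `]0, y]%classic = \bigcup_n `[u n, y]%classic.
  apply/seteqP; split=> [t|t [n _]] /=; rewrite !in_itv/=; last first.
    by move=> /andP[h ->]; rewrite (lt_le_trans (u0 n) h).
  move=> /andP[t0 ty].
  have [n _ /(_ n (leqnn n))] : \forall n \near \oo, u n < t.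
    by apply: (cvgr_lt 0).
  by move=> /= h; exists n => //=; rewrite in_itv/= ty (ltW h).
have cI : (\int[mu]_(t in `[u n, y]) (moebius_density c b t)%:E)%E @[n --> \oo] -->
    (\int[mu]_(t in \bigcup_n `[u n, y]%classic) (moebius_density c b t)%:E)%E.
  apply: ge0_nondecreasing_set_cvg_integral => //.
  - move=> m n mn; rewrite subsetEset => t /=; rewrite !in_itv/= => /andP[h ->].
    by rewrite (le_trans (und _ _ mn) h).
  - move=> n; apply/measurable_EFinP/measurable_funTS.
    exact: measurable_moebius_density.
  - by move=> n t _; rewrite lee_fin moebius_density_ge0.
have cF : (\int[mu]_(t in `[u n, y]) (moebius_density c b t)%:E)%E @[n --> \oo] -->
   ((moebius c y `^ (b + 1) / (b + 1))%:E).
  under eq_fun do rewrite integral_pos//.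
  apply: cvg_EFin; first exact: nearW.
  apply: cvgM; last exact: cvg_cst.
  rewrite -[X in _ --> X]subr0; apply: cvgB; first exact: cvg_cst.
  apply: (@squeeze_cvgr _ _ _ _ (fun=> 0) (fun n => u n `^ (b + 1))).
  - apply: nearW => n; rewrite powR_ge0/=; apply: ge0_ler_powR.
    + by lra.
    + by rewrite nnegrE moebius_ge0// ltW.
    + by rewrite nnegrE ltW.
    + by rewrite moebius_le// ltW.
  - exact: cvg_cst.
  - have := @powR_cvg0 R (b + 1); have -> : 0 < b + 1 by lra.
    move=> /(_ isT) /cvg_at_rightP; apply; split => //.
exact: (cvg_unique _ cI cF).
Qed.

End moebius.

(** * Determinants of increments *)

Section vandermonde_determinants.

(** Border the matrix by a first column of ones: subtracting consecutive rows
    undoes it. The row operations are multiplication by the triangular matrix S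
    of partial sums. *)
Lemma det_row_increments (K : comNzRingType) n (f : nat -> 'I_n -> K) :
  \det (\matrix_(i < n, j < n) (f i.+1 j - f i j)) =
  \det (\matrix_(i < n.+1, j < n.+1)
    (if unlift ord0 j is Some k then f i k else 1)).
Proof.
pose g (i : nat) (j : 'I_n.+1) := if unlift ord0 j is Some k then f i k else 1.
pose D := \matrix_(i < n.+1, j < n.+1) (if i : nat is k.+1 then g k.+1 j - g k j else g 0 j).
pose S := \matrix_(i < n.+1, j < n.+1) (j <= i)%:R : 'M[K]_n.+1.
have -> : \matrix_(i < n.+1, j < n.+1) g i j = S *m D.
  apply/matrixP => i j; rewrite !mxE.
  under eq_bigr do rewrite !mxE.
  pose h (k : nat) := (k <= i)%:R * (if k is k'.+1 then g k'.+1 j - g k' j else g 0 j).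
  rewrite -(big_mkord xpredT h) (@big_cat_nat _ _ _ i.+1)//=.
  rewrite [X in _ + X]big_nat_cond [X in _ + X]big1 ?addr0; last first.
    by move=> k /andP[/andP[ik _] _]; rewrite /h leqNgt ik mul0r.
  rewrite big_nat_recl//= {1}/h mul1r.
  transitivity (g 0 j + \sum_(0 <= k < i) (g k.+1 j - g k j)).
    by rewrite telescope_sumr// addrC subrK.
  by congr (_ + _); apply: eq_big_nat => k /andP[_ ki]; rewrite /h ki mul1r.
rewrite det_mulmx det_trig; last first.
  by apply/is_trig_mxP => i j ij; rewrite mxE leqNgt ij.
rewrite big1 ?mul1r; last by move=> i _; rewrite mxE leqnn.
rewrite (expand_det_col D ord0) big_ord_recl big1 ?addr0; last first.
  by move=> i _; rewrite !mxE/= /g unlift_none subrr mul0r.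
rewrite !mxE/= /g unlift_none mul1r /cofactor addn0 expr0 mul1r.
by congr (\det _); apply/matrixP => i j; rewrite !mxE/= /g liftK.
Qed.

Lemma det_power_increments (K : comNzRingType) n (q : nat -> K) :
  \det (\matrix_(i < n, j < n) (q i.+1 ^+ j.+1 - q i ^+ j.+1)) =
  \prod_(i < n.+1) \prod_(j < n.+1 | (i < j)%N) (q j - q i).
Proof.
rewrite (det_row_increments (fun i (j : 'I_n) => q i ^+ j.+1)).
transitivity (\det (Vandermonde n.+1 (\row_i q i))).
  rewrite -det_tr; congr (\det _); apply/matrixP => i j; rewrite !mxE.
  by case: unliftP => [k ->|->]; rewrite ?expr0.
rewrite det_Vandermonde; apply: eq_bigr => i _; apply: eq_bigr => j _.
by rewrite !mxE.
Qed.

End vandermonde_determinants.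

Section vandermonde_real.
Context {R : realType}.

Lemma powR_mul_expn (x a : R) j : 0 <= x -> -1 < a ->
  x `^ a * x ^+ j = x `^ (a + j%:R).
Proof.
move=> x0 a1; case: (posnP j) => [->|j0]; first by rewrite expr0 mulr1 addr0.
have j1 : 1 <= j%:R :> R by rewrite ler1n.
rewrite powRD ?powR_mulrn//; apply/implyP => /eqP h; lra.
Qed.

(** Since q 0 = 0, the first row of the bordered matrix is (1, 0, ..., 0), and
    what is left is a Vandermonde matrix with rescaled rows. *)
Lemma det_powR_increments n (a : R) (q : nat -> R) : -1 < a -> q 0%N = 0 ->
  (forall i : 'I_n, 0 <= q i.+1) ->
  \det (\matrix_(i < n, j < n) (q i.+1 `^ (a + j%:R + 1) - q i `^ (a + j%:R + 1))) =
  (\prod_(i < n) q i.+1 `^ (a + 1)) *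
  \prod_(i < n) \prod_(j < n | (i < j)%N) (q j.+1 - q i.+1).
Proof.
move=> a1 q0 qge0.
rewrite (det_row_increments (fun i (j : 'I_n) => q i `^ (a + j%:R + 1))).
rewrite (expand_det_row _ ord0) big_ord_recl big1 ?addr0; last first.
  move=> j _; rewrite !mxE liftK q0 powR0 ?mul0r// lt0r_neq0//.
  by have : 0 <= j%:R :> R by []; lra.
rewrite !mxE unlift_none mul1r /cofactor addn0 expr0 mul1r.
pose d := \row_(i < n) q i.+1 `^ (a + 1).
transitivity (\det (diag_mx d *m (Vandermonde n (\row_i q i.+1))^T)).
  congr (\det _); apply/matrixP => i j; rewrite mul_diag_mx !mxE liftK/=.
  by rewrite powR_mul_expn//; [congr (_ `^ _); ring|lra].
rewrite det_mulmx det_diag det_tr det_Vandermonde; congr (_ * _).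
  by apply: eq_bigr => i _; rewrite mxE.
apply: eq_bigr => i _; apply: eq_bigr => j _.
by rewrite !mxE.
Qed.

(** Each index lies in n - 1 pairs. *)
Lemma prod_pairs n (d : 'I_n -> R) :
  \prod_(i < n) \prod_(j < n | (i < j)%N) (d i * d j) =
  \prod_(i < n) d i ^+ n.-1.
Proof.
transitivity ((\prod_(i < n) \prod_(j < n | (i < j)%N) d i) *
  \prod_(i < n) \prod_(j < n | (i < j)%N) d j).
  by rewrite -big_split; apply: eq_bigr => i _; rewrite big_split.
rewrite [X in _ * X](exchange_big_dep predT)//= -big_split; apply: eq_bigr => i _ /=.
rewrite -[n in RHS]card_ord -(cardC1 i) -prodr_const.
rewrite [RHS](bigID (fun j : 'I_n => (i < j)%N))/=; congr (_ * _); apply: eq_bigl => j.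
  by rewrite inE -val_eqE/=; case: ltngtP.
by rewrite inE -val_eqE/=; case: ltngtP.
Qed.

End vandermonde_real.

(** * Exact evaluation of cell integrals *)

Section det_integral.
Context {R : realType}.
Local Open Scope ereal_scope.
Local Notation mu := (@lebesgue_measure R).

Lemma integrable_leb_prod n (h : 'I_n -> R -> R) :
  (forall i, measurable_fun setT (h i)) -> (forall i x, (0 <= h i x)%R) ->
  (forall i, \int[mu]_x (h i x)%:E < +oo) ->
  (leb R n).-integrable setT (fun t => (\prod_(i < n) h i (tnth t i))%:E).
Proof.
move=> mh h0 hoo; apply/integrableP; split.
  by apply/measurable_EFinP; exact: measurable_coords_prod.
under eq_integral do rewrite gee0_abs ?lee_fin ?prodr_ge0//.
rewrite ge0_integral_leb_prod//.
suff /andP[] : (0 <= \prod_(i < n) \int[mu]_x (h i x)%:E < +oo) by [].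
elim/big_ind: _.
- by rewrite ltry lee_fin ler01.
- move=> x y /andP[x1 x2] /andP[y1 y2]; rewrite mule_ge0//=.
  by rewrite lte_mul_pinfty// ge0_fin_numE.
- by move=> i _; rewrite hoo andbT integral_ge0// => x _; rewrite lee_fin.
Qed.

(** Expand the determinant over permutations: each term is a product of
    one-variable functions, and integrates to the product of the integrals. *)
Lemma integral_leb_det n (H : 'I_n -> 'I_n -> R -> R) (M : 'I_n -> 'I_n -> R) :
  (forall i j, measurable_fun setT (H i j)) -> (forall i j x, (0 <= H i j x)%R) ->
  (forall i j, \int[mu]_x (H i j x)%:E = (M i j)%:E) ->
  (leb R n).-integrable setT
     (fun t => (\det (\matrix_(i, j) H i j (tnth t i)))%:E) /\
  \int[leb R n]_t (\det (\matrix_(i, j) H i j (tnth t i)))%:E =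
  (\det (\matrix_(i, j) M i j))%:E.
Proof.
move=> mH H0 HM.
have intp (s : {perm 'I_n}) : (leb R n).-integrable setT
    (fun t => (\prod_(i < n) H i (s i) (tnth t i))%:E).
  by apply: (@integrable_leb_prod _ (fun i => H i (s i))) => // i; rewrite HM ltry.
pose G (s : {perm 'I_n}) (t : Rtuple R n) :=
  ((-1) ^+ s * \prod_(i < n) H i (s i) (tnth t i))%:E.
have intG s : (leb R n).-integrable setT (G s).
  by rewrite /G; under eq_fun do rewrite EFinM; exact: integrableZl.
have -> : (fun t : Rtuple R n => (\det (\matrix_(i, j) H i j (tnth t i)))%:E) =
    (fun t => \sum_s G s t).
  apply/funext => t; rewrite /determinant -sumEFin; apply: eq_bigr => s _.
  by rewrite /G; congr (_ * _)%:E; apply: eq_bigr => i _; rewrite mxE.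
split; first exact: integrable_sum.
rewrite integral_sum// /determinant -sumEFin; apply: eq_bigr => s _.
rewrite /G; under eq_integral do rewrite EFinM.
rewrite integralZl// (@ge0_integral_leb_prod _ _ (fun i => H i (s i)))//.
rewrite (eq_bigr (fun i => (M i (s i))%:E)) => [|i _]; last exact: HM.
rewrite prodEFin -EFinM; congr (_ * _)%:E.
by apply: eq_bigr => i _; rewrite mxE.
Qed.

End det_integral.

Section weight.
Context {R : realType}.
Local Notation mu := (@lebesgue_measure R).

(** Both kernels are, up to a factor that does not depend on t, integration
    against such a weight: the i-th coordinate of t lies between the
    nodes p i and p i.+1. *)
Definition weight (a : R) n (p : nat -> R) (t : Rtuple R n) : R :=
  (\prod_(i < n) (\1_(`[p i, p i.+1]) (tnth t i : R) * (tnth t i : R) `^ a)) *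
  vandermonde (vec t).

(** The test functions on which the kernels are computed exactly. For c = 0 they
    are the constant 1; for c = 1 and q > 0 they are positive and tend to 0 at
    infinity on the nonnegative tuples. *)
Definition decay (q c : R) n (t : Rtuple R n) : R :=
  \prod_(i < n) (1 + c * tnth t i) `^ (- q).

Definition nodes n (p : nat -> R) :=
  0 <= p 0%N /\ forall i, (i < n)%N -> p i <= p i.+1.

Lemma vandermonde_vec n (t : Rtuple R n) :
  vandermonde (vec t) = \prod_(i < n) \prod_(j < n | (i < j)%N) (tnth t j - tnth t i : R).
Proof.
by apply: eq_bigr => i _; apply: eq_bigr => j _; rewrite !mxE.
Qed.

Lemma nodes_le n (p : nat -> R) i j : nodes n p -> (i <= j)%N -> (j <= n)%N -> p i <= p j.
Proof.
move=> [p0 pS]; elim: j => [|j IH]; first by rewrite leqn0 => /eqP ->.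
rewrite leq_eqVlt => /predU1P[-> //|ij] jn.
by apply: (le_trans (IH _ _)) => //; [exact: ltnW|exact: pS].
Qed.

Lemma nodes_ge0 n (p : nat -> R) i : nodes n p -> (i <= n)%N -> 0 <= p i.
Proof. by move=> np ni; rewrite (le_trans np.1)// (nodes_le np). Qed.

Lemma weight_out a n (p : nat -> R) (t : Rtuple R n) :
  ~ (forall i : 'I_n, p i <= tnth t i <= p i.+1) -> weight a p t = 0.
Proof.
move=> /existsNP[i hi]; rewrite /weight (bigD1 i)//= indicE.
by rewrite memNset ?mul0r//= in_itv.
Qed.

Lemma weight_in a n (p : nat -> R) (t : Rtuple R n) :
  (forall i : 'I_n, p i <= tnth t i <= p i.+1) ->
  weight a p t = (\prod_(i < n) (tnth t i : R) `^ a) * vandermonde (vec t).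
Proof.
move=> h; congr (_ * _); apply: eq_bigr => i _.
by rewrite indicE mem_set ?mul1r//= in_itv/= h.
Qed.

Lemma weight_ge0 a n (p : nat -> R) (t : Rtuple R n) : nodes n p -> 0 <= weight a p t.
Proof.
move=> np; case: (pselect (forall i : 'I_n, p i <= tnth t i <= p i.+1)) => h; last first.
  by rewrite weight_out.
rewrite weight_in// vandermonde_vec mulr_ge0// prodr_ge0// => i _.
  exact: powR_ge0.
apply: prodr_ge0 => j ij; rewrite subr_ge0.
have /andP[_ hi] := h i; have /andP[hj _] := h j.
by rewrite (le_trans hi)// (le_trans _ hj)// (nodes_le np)// ltnW.
Qed.

Lemma moebius_powR c a (y : R) : 0 <= c -> 0 <= y ->
  moebius c y `^ a = y `^ a * (1 + c * y) `^ (- a).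
Proof.
move=> c0 y0; have d0 := moebius_den_gt0 c0 y0.
rewrite /moebius powRM// ?invr_ge0 ?ltW// -powR_inv1 ?ltW// -powRrM.
by rewrite mulN1r.
Qed.

Lemma powR_expnV (x : R) k : 0 <= x -> (x ^+ k)^-1 = x `^ (- k%:R).
Proof. by move=> x0; rewrite powRN powR_mulrn. Qed.

Lemma prod_moebiusB c n (y : 'I_n -> R) : 0 <= c -> (forall i, 0 <= y i) ->
  \prod_(i < n) \prod_(j < n | (i < j)%N) (moebius c (y j) - moebius c (y i)) =
  (\prod_(i < n) \prod_(j < n | (i < j)%N) (y j - y i)) *
  \prod_(i < n) (1 + c * y i) ^- n.-1.
Proof.
move=> c0 y0.
transitivity ((\prod_(i < n) \prod_(j < n | (i < j)%N) (y j - y i)) *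
    \prod_(i < n) \prod_(j < n | (i < j)%N) ((1 + c * y i)^-1 * (1 + c * y j)^-1)).
  rewrite -big_split; apply: eq_bigr => i _ /=; rewrite -big_split.
  by apply: eq_bigr => j _ /=; rewrite moebiusB// invfM.
rewrite (prod_pairs (fun i => (1 + c * y i)^-1)); congr (_ * _).
by apply: eq_bigr => i _; rewrite exprVn.
Qed.

(** In the variables [moebius c (tnth t i)] the Vandermonde product absorbs a
    factor [1 + c * tnth t i] to the power n - 1 and the Jacobian two more, so
    that the exponent a + n + 1 turns the weight into a plain determinant of
    one-variable functions. *)
Lemma weight_decayE a c n (p : nat -> R) (t : Rtuple R n) :
  -1 < a -> 0 <= c -> nodes n p ->
  weight a p t * decay (a + n%:R + 1) c t =
  \det (\matrix_(i < n, j < n)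
    (\1_(`[p i, p i.+1]) (tnth t i : R) * moebius_density c (a + j%:R) (tnth t i))).
Proof.
move=> a1 c0 np; case: n p t np => [|n] p t np.
  by rewrite det_mx00 /weight vandermonde_vec /decay !big_ord0 !mulr1.
pose d := \row_(i < n.+1) (\1_(`[p i, p i.+1]) (tnth t i : R) *
   (moebius c (tnth t i) `^ a / (1 + c * tnth t i) ^+ 2)).
transitivity (\det (diag_mx d *m (Vandermonde n.+1 (\row_i moebius c (tnth t i : R)))^T));
    last first.
  congr (\det _); apply/matrixP => i j; rewrite mul_diag_mx !mxE.
  rewrite indicE; case: (boolP (_ \in _)) => [|_]; last by rewrite !mul0r.
  rewrite inE/= in_itv/= => /andP[pi _].
  have y0 : 0 <= tnth t i by rewrite (le_trans _ pi)// (nodes_ge0 np)// ltnW.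
  by rewrite !mul1r /moebius_density -powR_mul_expn// ?moebius_ge0//; ring.
rewrite det_mulmx det_diag det_tr det_Vandermonde /weight vandermonde_vec.
case: (pselect (forall i : 'I_n.+1, p i <= tnth t i <= p i.+1)) => h; last first.
  have [i hi] : exists i : 'I_n.+1, ~ (p i <= tnth t i <= p i.+1) by exact/existsNP.
  have hi' : (tnth t i : R) \notin (`[p i, p i.+1]%classic : set R).
    by rewrite notin_setE /= in_itv.
  rewrite (bigD1 i)//= [in RHS](bigD1 i)//= mxE indicE (negbTE hi').
  by rewrite !mul0r.
have y0 i : 0 <= tnth t i :> R.
  by have /andP[pi _] := h i; rewrite (le_trans _ pi)// (nodes_ge0 np)// ltnW.
under [in RHS]eq_bigr do rewrite mxE.
under [X in _ = _ * X]eq_bigr do under eq_bigr do rewrite !mxE.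
rewrite (@prod_moebiusB c _ (fun i => tnth t i : R))//.
rewrite [RHS]mulrCA -[LHS]mulrA [LHS]mulrCA; congr (_ * _).
rewrite -!big_split/=; apply: eq_bigr => i _.
rewrite ?mxE -!mulrA; congr (_ * _).
have e0 := moebius_den_gt0 c0 (y0 i).
rewrite moebius_powR// !powR_expnV ?ltW// -!mulrA; congr (_ * _).
rewrite -!powRD ?(lt0r_neq0 e0) ?implybT//; congr (_ `^ _).
by rewrite -natr1; ring.
Qed.

Let cell_integral a c n (p : nat -> R) (i j : 'I_n) : -1 < a -> 0 <= c -> nodes n p ->
  (\int[mu]_x (\1_(`[p i, p i.+1]) x * moebius_density c (a + j%:R) x)%:E =
   ((moebius c (p i.+1) `^ (a + j%:R + 1) - moebius c (p i) `^ (a + j%:R + 1)) /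
     (a + j%:R + 1))%:E)%E.
Proof.
move=> a1 c0 np.
rewrite -(@integral_moebius_density R c (a + j%:R))//; last 3 first.
- by have : 0 <= j%:R :> R by []; lra.
- by rewrite (nodes_ge0 np)// ltnW.
- by apply: np.2.
rewrite [RHS]integral_mkcond; apply: eq_integral => x _.
by rewrite epatch_indic EFinM muleC.
Qed.

Lemma integral_weight_decay_det a c n (p : nat -> R) : -1 < a -> 0 <= c -> nodes n p ->
  (leb R n).-integrable setT (EFin \o (fun t => weight a p t * decay (a + n%:R + 1) c t)) /\
  \int[leb R n]_t (weight a p t * decay (a + n%:R + 1) c t) =
  (poch (a + 1) n)^-1 * \det (\matrix_(i < n, j < n)
    (moebius c (p i.+1) `^ (a + j%:R + 1) - moebius c (p i) `^ (a + j%:R + 1))).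
Proof.
move=> a1 c0 np.
have [] := @integral_leb_det R n
  (fun i j x => \1_(`[p i, p i.+1]) x * moebius_density c (a + j%:R) x)
  (fun i j => (moebius c (p i.+1) `^ (a + j%:R + 1) - moebius c (p i) `^ (a + j%:R + 1)) /
     (a + j%:R + 1)).
- move=> i j; apply: measurable_funM; last exact: measurable_moebius_density.
  exact: measurable_indic.
- by move=> i j x; rewrite mulr_ge0// moebius_density_ge0.
- by move=> i j; exact: cell_integral.
under eq_fun do rewrite -weight_decayE//.
move=> h1 h2; split => //.
rewrite /Rintegral.
rewrite h2/=.
pose d := \row_(j < n) (a + j%:R + 1)^-1.
rewrite (_ : \matrix_(i, j) _ = (\matrix_(i < n, j < n)
    (moebius c (p i.+1) `^ (a + j%:R + 1) - moebius c (p i) `^ (a + j%:R + 1))) *m diag_mx d).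
  rewrite det_mulmx det_diag mulrC; congr (_ * _).
  rewrite /poch big_mkord -prodfV.
  by apply: eq_bigr => i _; rewrite mxE; congr (_ ^-1); ring.
by apply/matrixP => i j; rewrite mul_mx_diag !mxE.
Qed.

(** The value is the same expression in the nodes, with the exponent lowered by
    one: after division by the normalising factor only a product of powers of
    [1 + c * p i.+1] remains. *)
Lemma integral_weight_decay_NN a c n (p : nat -> R) : -1 < a -> 0 <= c ->
  nodes n p -> p 0%N = 0 ->
  \int[leb R n]_t (weight a p t * decay (a + n%:R + 1) c t) =
  (poch (a + 1) n)^-1 * (\prod_(i < n) p i.+1 `^ (a + 1)) *
  (\prod_(i < n) \prod_(j < n | (i < j)%N) (p j.+1 - p i.+1)) *
  \prod_(i < n) (1 + c * p i.+1) `^ (- (a + n%:R)).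
Proof.
move=> a1 c0 np p0; rewrite (integral_weight_decay_det a1 c0 np).2.
have pge0 (i : 'I_n) : 0 <= p i.+1 by exact: (nodes_ge0 np).
rewrite (@det_powR_increments _ n a (fun i => moebius c (p i)))//; last 2 first.
- by rewrite p0 /moebius mul0r.
- by move=> i; exact: moebius_ge0.
rewrite (@prod_moebiusB c _ (fun i : 'I_n => p i.+1))//.
rewrite -!mulrA; congr (_ * _); rewrite [RHS]mulrCA [LHS]mulrCA; congr (_ * _).
rewrite -!big_split/=; apply: eq_bigr => i _.
have e0 := moebius_den_gt0 c0 (pge0 i).
rewrite moebius_powR// powR_expnV ?ltW// -!mulrA; congr (_ * _).
rewrite -powRD ?(lt0r_neq0 e0) ?implybT//; congr (_ `^ _).
case: n np i {e0} pge0 => [|n] _ i _; first by case: i.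
by rewrite /= -natr1; ring.
Qed.

(** Without the assumption p 0 = 0 the determinant of increments is a full
    Vandermonde product over all n + 1 nodes provided that the exponents are
    integers, that is a = 0. *)
Lemma integral_weight_decay_SN c n (p : nat -> R) : 0 <= c -> nodes n p ->
  \int[leb R n]_t (weight 0 p t * decay (n%:R + 1) c t) =
  (poch 1 n)^-1 * (\prod_(i < n.+1) \prod_(j < n.+1 | (i < j)%N) (p j - p i)) *
  \prod_(i < n.+1) (1 + c * p i) `^ (- n%:R).
Proof.
move=> c0 np.
have := (@integral_weight_decay_det 0 c n p ltac:(lra) c0 np).2.
rewrite !add0r => ->; rewrite -mulrA; congr (_ * _).
have pge0 (i : 'I_n.+1) : 0 <= p i by apply: (nodes_ge0 np); rewrite -ltnS.
transitivity (\det (\matrix_(i < n, j < n)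
    (moebius c (p i.+1) ^+ j.+1 - moebius c (p i) ^+ j.+1))).
  congr (\det _); apply/matrixP => i j; rewrite !mxE !add0r natr1.
  rewrite !powR_mulrn// moebius_ge0//.
    exact: (pge0 (widen_ord (leqnSn n) i)).
  exact: (pge0 (lift ord0 i)).
rewrite (det_power_increments n (fun i => moebius c (p i))).
rewrite (@prod_moebiusB c _ (fun i : 'I_n.+1 => p i))//; congr (_ * _).
apply: eq_bigr => i _; rewrite powR_expnV//.
by rewrite ltW// moebius_den_gt0.
Qed.

Lemma measurable_vandermonde n :
  measurable_fun [set: Rtuple R n] (fun t => vandermonde (vec t)).
Proof.
under eq_fun do rewrite vandermonde_vec.
apply: measurable_prod => i _.
under eq_fun do rewrite big_mkcond.
apply: measurable_prod => j _; case: (i < j)%N => //.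
by apply: measurable_funB; exact: measurable_tnth.
Qed.

Lemma measurable_weight a n p : measurable_fun [set: Rtuple R n] (weight a p).
Proof.
apply: measurable_funM; last exact: measurable_vandermonde.
apply: (@measurable_coords_prod _ _ (fun i x => \1_(`[p i, p i.+1]) x * x `^ a)) => i.
by apply: measurable_funM; [exact: measurable_indic|exact: measurable_powR].
Qed.

End weight.

(** * Continuity and comparison of cell integrals *)

Section cell_kernel.
Context {R : realType}.
Local Notation mu := (@lebesgue_measure R).

Definition cell_integral (a : R) n (p : nat -> R) (g : Rtuple R n -> R) : R :=
  \int[leb R n]_t (weight a p t * g t).

Lemma decay0 q n (t : Rtuple R n) : decay q 0 t = 1.
Proof. by rewrite /decay big1// => i _; rewrite mul0r addr0 powR1. Qed.

Definition weight_integrable a n (p : nat -> R) (g : Rtuple R n -> R) :=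
  (leb R n).-integrable setT (fun t => (weight a p t * g t)%:E).

(** The exact evaluation at c = 0. *)
Lemma integrable_weight a n (p : nat -> R) : -1 < a -> nodes n p ->
  (leb R n).-integrable setT (EFin \o weight a p).
Proof.
move=> a1 np; have := (integral_weight_decay_det a1 (lexx 0) np).1.
by under eq_fun do rewrite decay0 mulr1.
Qed.

Lemma integrable_weightM a n (p : nat -> R) (g : Rtuple R n -> R) (C : R) :
  -1 < a -> nodes n p -> measurable_fun setT g -> (forall t, `|g t| <= C) ->
  weight_integrable a p g.
Proof.
move=> a1 np mg gC.
apply: (@le_integrable _ _ _ _ _ measurableT _ (fun t => (C * weight a p t)%:E)) => //.
- by apply/measurable_EFinP/measurable_funM => //; exact: measurable_weight.
- move=> t _; rewrite !abse_EFin lee_fin !normrM mulrC ler_wpM2r//.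
  by rewrite (le_trans (gC t))// ler_norm.
- under eq_fun do rewrite EFinM.
  by apply: integrableZl => //; exact: integrable_weight.
Qed.

Lemma ae_leb_coord_neq n (i : 'I_n) (v : R) :
  \forall t \ae leb R n, tnth t i <> v.
Proof.
pose A (j : 'I_n) : set (measurableTypeR R) := if j == i then [set v] else setT.
have mA j : measurable (A j) by rewrite /A; case: ifP.
exists [set t | forall j, A j (tnth t j)]; split.
- exact: measurable_box.
- rewrite leb_box// (bigD1 i)//= {1}/A eqxx.
  have -> : lebesgue_measure [set v] = 0%E by exact: lebesgue_measure_set1.
  by rewrite mul0e.
- move=> t /= /contrapT tv j; rewrite /A; case: eqP => [->|//].
  exact: tv.
Qed.

Lemma vandermonde_bound n (t : Rtuple R n) (M : R) :
  (forall i, 0 <= (tnth t i : R) <= M) ->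
  `|vandermonde (vec t)| <= \prod_(i < n) \prod_(j < n | (i < j)%N) M.
Proof.
move=> tM; rewrite vandermonde_vec normr_prod; apply: ler_prod => i _.
rewrite normr_ge0/= normr_prod; apply: ler_prod => j _; rewrite normr_ge0/=.
have /andP[? ?] := tM i; have /andP[? ?] := tM j.
by rewrite ler_norml; apply/andP; split; lra.
Qed.

(** Dominated convergence: if no coordinate of t is one of the limiting nodes,
    then the weight at t is eventually equal to its limit, and all weights are
    supported in a common cube [0, M]^n. *)
Lemma cvg_cell_integral a n (p_ : nat -> nat -> R) (p : nat -> R)
    (g : Rtuple R n -> R) (C : R) :
  -1 < a -> (forall k, nodes n (p_ k)) -> nodes n p ->
  (forall i, (i <= n)%N -> p_ k i @[k --> \oo] --> p i) ->
  measurable_fun setT g -> (forall t, `|g t| <= C) ->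
  cell_integral a (p_ k) g @[k --> \oo] --> cell_integral a p g.
Proof.
move=> a1 np_ np pp mg gC.
have C0 : 0 <= C by rewrite (le_trans _ (gC (nseq_tuple n 0))).
have [M M0 pM] : exists2 M, 0 <= M & forall k, p_ k n <= M.
  have /cvg_seq_bounded[M [_ HM]] : cvgn (p_ ^~ n).
    by apply/cvg_ex; exists (p n); exact: pp.
  have h k : `|p_ k n| <= M + 1 by apply: (HM (M + 1)); rewrite ?ltrDl.
  exists (M + 1); first by rewrite (le_trans _ (h 0%N)).
  by move=> k; rewrite (le_trans _ (h k))// ler_norm.
(* the dominating function: on the cube each factor of the Vandermonde product
   is at most M *)
pose D t := (C * \prod_(i < n) \prod_(j < n | (i < j)%N) M) *
   \prod_(i < n) (\1_(`[0, M]) (tnth t i : R) * (tnth t i : R) `^ a).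
have Dweight k (t : Rtuple R n) : `|weight a (p_ k) t * g t| <= D t.
  case: (pselect (forall i : 'I_n, p_ k i <= tnth t i <= p_ k i.+1)) => h; last first.
    rewrite weight_out// mul0r normr0 /D mulr_ge0//.
      by rewrite mulr_ge0// prodr_ge0// => i _; rewrite prodr_ge0.
    by rewrite prodr_ge0// => i _; rewrite mulr_ge0// powR_ge0.
  have tM i : 0 <= (tnth t i : R) <= M.
    have /andP[h1 h2] := h i; apply/andP; split.
      by rewrite (le_trans _ h1)// (nodes_ge0 (np_ k))// ltnW.
    by rewrite (le_trans h2)// (le_trans _ (pM k))// (nodes_le (np_ k)).
  rewrite weight_in// normrM mulrC /D normrM -mulrA ler_pM//.
  rewrite mulrC ler_pM//; first exact: vandermonde_bound.
  rewrite normr_prod; apply: ler_prod => i _; rewrite normr_ge0/=.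
  by rewrite ger0_norm ?powR_ge0// indicE mem_set ?mul1r//= in_itv/= tM.
have intD : (leb R n).-integrable setT (EFin \o D).
  pose K : R := C * \prod_(i < n) \prod_(j < n | (i < j)%N) M.
  rewrite (_ : EFin \o D = (fun t => K%:E *
      (\prod_(i < n) (\1_(`[0%R, M]) (tnth t i : R) * (tnth t i : R) `^ a))%:E)%E)//.
  apply: integrableZl => //.
  apply: (@integrable_leb_prod _ _ (fun i x => \1_(`[0, M]) x * x `^ a)) => i.
  - by apply: measurable_funM; [exact: measurable_indic|exact: measurable_powR].
  - by move=> x; rewrite mulr_ge0// powR_ge0.
  have -> : (\int[mu]_x (\1_(`[0%R, M]) x * x `^ a)%:E =
      \int[mu]_(x in `[0%R, M]) (moebius_density 0 a x)%:E)%E.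
    rewrite [RHS]integral_mkcond; apply: eq_integral => x _.
    rewrite epatch_indic EFinM muleC; congr (_ * _)%E.
    by rewrite /moebius_density /moebius mul0r addr0 expr1n !divr1.
  by rewrite integral_moebius_density// ltry.
have aew : \forall t \ae leb R n, [set: Rtuple R n] t ->
    (weight a (p_ k) t * g t)%:E @[k --> \oo] --> (weight a p t * g t)%:E.
  have FF := @ae_filter_ringOfSetsType _ (Rtuple R n) R (leb R n).
  have h (i : 'I_n) : \forall t \ae leb R n, tnth t i <> p i /\ tnth t i <> p i.+1.
    have h1 := @ae_leb_coord_neq n i (p i); have h2 := @ae_leb_coord_neq n i (p i.+1).
    by apply: (@filterS2 _ _ FF _ _ _ _ h1 h2).
  have := @filter_forall _ _ _ _ FF h; apply: (@filterS _ _ FF) => t ht _.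
  apply: cvg_EFin; first exact: nearW.
  apply: cvgM; last exact: cvg_cst.
  apply: cvg_near_cst.
  case: (pselect (forall i : 'I_n, p i <= tnth t i <= p i.+1)) => tp.
    have : \forall k \near \oo, forall i : 'I_n, p_ k i <= tnth t i <= p_ k i.+1.
      apply: filter_forall => i; have [h1 h2] := ht i.
      have /andP[h3 h4] := tp i.
      have h5 : \forall k \near \oo, p_ k i < tnth t i.
        apply: (cvgr_lt (p i)); first by apply: pp; exact: ltnW.
        by rewrite lt_neqAle h3 andbT eq_sym; exact/eqP.
      have h6 : \forall k \near \oo, tnth t i < p_ k i.+1.
        apply: (cvgr_gt (p i.+1)); first exact: pp.
        by rewrite lt_neqAle h4 andbT; exact/eqP.
      by apply: filterS2 h5 h6 => k h5 h6; rewrite !ltW.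
    by apply: filterS => k tk; rewrite !weight_in.
  have [i /negP hi] : exists i : 'I_n, ~ (p i <= tnth t i <= p i.+1).
    exact/existsNP.
  move: hi; rewrite negb_and -!ltNge => /orP[hi|hi].
    have : \forall k \near \oo, tnth t i < p_ k i.
      by apply: (cvgr_gt (p i)) => //; apply: pp; exact: ltnW.
    apply: filterS => k tk; rewrite !weight_out//.
    by move=> /(_ i); rewrite leNgt tk.
  have : \forall k \near \oo, p_ k i.+1 < tnth t i.
    by apply: (cvgr_lt (p i.+1)) => //; exact: pp.
  apply: filterS => k tk; rewrite !weight_out//.
  by move=> /(_ i); rewrite andbC leNgt tk.
have [] := @dominated_convergence _ _ _ (leb R n) setT measurableT
  (fun k t => (weight a (p_ k) t * g t)%:E) (fun t => (weight a p t * g t)%:E)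
  (EFin \o D).
- move=> k; apply/measurable_EFinP/measurable_funM => //; exact: measurable_weight.
- apply/measurable_EFinP/measurable_funM => //; exact: measurable_weight.
- exact: aew.
- exact: intD.
- by apply: nearW => t k _; rewrite abse_EFin lee_fin.
move=> ip _ H; apply: fine_cvg; rewrite fineK//.
exact: integrable_fin_num.
Qed.

Lemma cell_integral_le a n (p : nat -> R) (f g : Rtuple R n -> R) :
  nodes n p -> weight_integrable a p f -> weight_integrable a p g ->
  (forall t, (forall i, 0 <= (tnth t i : R)) -> f t <= g t) ->
  cell_integral a p f <= cell_integral a p g.
Proof.
move=> np intf intg fg; apply: le_Rintegral => // t _.
case: (pselect (forall i : 'I_n, p i <= tnth t i <= p i.+1)) => h.
  rewrite ler_wpM2l ?weight_ge0// fg// => i.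
  by have /andP[pi _] := h i; rewrite (le_trans _ pi)// (nodes_ge0 np)// ltnW.
by rewrite weight_out ?mul0r.
Qed.

Lemma cell_integral_affine a n (p : nat -> R) (g : Rtuple R n -> R) (b c : R) :
  -1 < a -> nodes n p -> weight_integrable a p g ->
  weight_integrable a p (fun t => b + c * g t) /\
  cell_integral a p (fun t => b + c * g t) =
  b * cell_integral a p (fun _ : Rtuple R n => 1) + c * cell_integral a p g.
Proof.
move=> a1 np intg.
have int1 : (leb R n).-integrable setT (EFin \o (fun t => weight a p t * 1)).
  apply: (@integrable_weightM a n p (cst 1) 1) => // t; by rewrite normr1.
have E t : weight a p t * (b + c * g t) = b * (weight a p t * 1) + c * (weight a p t * g t).
  by ring.
have intb : (leb R n).-integrable setT (EFin \o (fun t => b * (weight a p t * 1))).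
  exact: (integrableZl measurableT b int1).
have intc : (leb R n).-integrable setT (EFin \o (fun t => c * (weight a p t * g t))).
  exact: (integrableZl measurableT c intg).
split.
  rewrite /weight_integrable; under eq_fun do rewrite E EFinD.
  exact: integrableD.
rewrite /cell_integral; under eq_Rintegral do rewrite E.
by rewrite RintegralD// !RintegralZl.
Qed.

Lemma cell_integral_bound a n (p : nat -> R) (g : Rtuple R n -> R) C :
  -1 < a -> nodes n p -> measurable_fun setT g -> (forall t, `|g t| <= C) ->
  `|cell_integral a p g| <= C * cell_integral a p (fun _ : Rtuple R n => 1).
Proof.
move=> a1 np mg gC; have intg := integrable_weightM a1 np mg gC.
have [i1 e1] := cell_integral_affine (- C) 0 a1 np intg.
have [i2 e2] := cell_integral_affine C 0 a1 np intg.
rewrite ler_norml; apply/andP; split.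
  rewrite -mulNr -[leLHS]addr0 -(mul0r (cell_integral a p g)) -e1.
  apply: cell_integral_le => // t _; rewrite mul0r addr0.
  by have := gC t; rewrite ler_norml => /andP[].
rewrite -[leRHS]addr0 -(mul0r (cell_integral a p g)) -e2.
apply: cell_integral_le => // t _; rewrite mul0r addr0.
by have := gC t; rewrite ler_norml => /andP[].
Qed.

End cell_kernel.

(** * Topology and measurability of the cone W *)

Section row_vectors.
Context {R : realType}.

Lemma cvg_rowP n (u : nat -> 'rV[R]_n) (x : 'rV[R]_n) :
  u @ \oo --> x <-> forall i, u k ord0 i @[k --> \oo] --> x ord0 i.
Proof.
split=> [ux i|ux].
  exact: (cvg_comp u (fun v : 'rV[R]_n => v ord0 i) ux (@coord_continuous _ _ _ ord0 i x)).
apply/cvg_ballP => e e0.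
have : \forall k \near \oo, forall i, ball (x ord0 i) e (u k ord0 i).
  by apply: filter_forall => i; move/cvg_ballP : (ux i) => /(_ _ e0).
by apply: filterS => k uk; split => // i j; rewrite ord1.
Qed.

Lemma coord_le_norm n (v : 'rV[R]_n) i : `|v ord0 i| <= `|v|.
Proof.
have -> : `|v| = mx_norm v by [].
rewrite mx_normrE; apply/bigmax_geP; right => /=.
by exists (ord0, i).
Qed.

Lemma closed_W n : closed (@W R n).
Proof.
have -> : @W R n =
    (\bigcap_(i in [set: 'I_n]) [set x : 'rV[R]_n | 0 <= x ord0 i]) `&`
    (\bigcap_(ij in [set ij : 'I_n * 'I_n | (ij.1 <= ij.2)%N])
       [set x : 'rV[R]_n | 0 <= x ord0 ij.2 - x ord0 ij.1]).
  apply/seteqP; split=> [x [x0 xS]|x [x0 xS]].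
    split=> [i _|[i j]/= ij]; first exact: x0.
    by rewrite /= subr_ge0; exact: xS.
  split=> [i|i j ij]; first exact: x0.
  by rewrite -subr_ge0; exact: (xS (i, j)).
apply: closedI; apply: closed_bigI => i _.
  apply: (@closed_comp _ _ (fun x : 'rV[R]_n => x ord0 i) [set y | 0 <= y]).
    by move=> x _; exact: coord_continuous.
  exact: closed_ge.
apply: (@closed_comp _ _ (fun x : 'rV[R]_n => x ord0 i.2 - x ord0 i.1) [set y | 0 <= y]).
    move=> x _.
  exact: (cvgB (@coord_continuous R 1 n ord0 i.2 x) (@coord_continuous R 1 n ord0 i.1 x)).
exact: closed_ge.
Qed.

Lemma compact_W_le n (M : R) : compact [set x : 'rV[R]_n | W x /\ forall i, x ord0 i <= M].
Proof.
have c := @rV_compact R n (fun=> `[0, M]%classic) (fun=> @segment_compact R 0 M).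
rewrite (_ : mkset _ = [set v : 'rV[R]_n | forall i, `[0, M]%classic (v ord0 i)] `&` @W R n).
  by apply: compact_closedI => //; exact: closed_W.
apply/seteqP; split=> [x [Wx xM]|x [xM Wx]]; split=> // i.
  by rewrite /= in_itv/= Wx.1 xM.
by have := xM i; rewrite /= in_itv/= => /andP[].
Qed.

Lemma W_approx n (x : 'rV[R]_n) : W x ->
  exists u : nat -> 'rV[R]_n, (forall k, Wint (u k)) /\ u @ \oo --> x.
Proof.
move=> [x0 xS].
(* adding a small strictly increasing positive vector separates the coordinates *)
exists (fun k => \row_i (x ord0 i + i.+1%:R * k.+1%:R^-1)); split=> [k|].
  split=> [i|i j ij]; rewrite !mxE.
    by rewrite ltr_wpDl.
  apply: ler_ltD; first exact/xS/ltnW.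
  by rewrite ltr_pM2r// ltr_nat ltnS.
apply/cvg_rowP => i; under eq_fun do rewrite mxE.
suff : (x ord0 i + i.+1%:R * k.+1%:R^-1) @[k --> \oo] --> x ord0 i + i.+1%:R * 0.
  by rewrite mulr0 addr0.
apply: cvgD; first exact: cvg_cst.
apply: cvgM; first exact: cvg_cst.
exact: cvg_harmonic.
Qed.

Lemma Wint_W n (x : 'rV[R]_n) : Wint x -> W x.
Proof.
move=> [x0 xS]; split=> [i|i j]; first exact: ltW.
by rewrite leq_eqVlt => /predU1P[/val_inj ->//|/xS /ltW].
Qed.

(** Every point of W is a limit of interior points, so a sequence in W can be
    replaced by a nearby interior one on which G takes nearby values. *)
Lemma continuous_W_of_Wint n (G : 'rV[R]_n -> R) :
  (forall x u, W x -> (forall k, Wint (u k)) -> u @ \oo --> x ->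
    G (u k) @[k --> \oo] --> G x) ->
  {within @W R n, continuous G}.
Proof.
move=> GW; apply/subspace_continuousP => x Wx.
apply/cvgrPdist_lt => e e0.
have e20 : 0 < e / 2 by rewrite divr_gt0.
have [k xk] : exists k : nat, forall v, Wint v -> ball x (k.+1%:R^-1) v ->
    `|G x - G v| < e / 2.
  apply: contrapT => /forallNP h.
  have /choice[u hu] : forall k : nat, exists v, [/\ Wint v, ball x (k.+1%:R^-1) v &
      ~ `|G x - G v| < e / 2].
    move=> k; have /existsNP[v /not_implyP[Wv /not_implyP[xv nv]]] := h k.
    by exists v.
  have ux : u @ \oo --> x.
    apply/cvg_ballP => d d0.
    have [m _ hm] := near_infty_natSinv_lt (PosNum d0).
    exists m => // k /hm /= kd; have [_ + _] := hu k.
    by apply: le_ball; exact: ltW.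
  have := GW x u Wx (fun k => let: And3 a _ _ := hu k in a) ux.
  move=> /cvgrPdist_lt /(_ _ e20) [m _ /(_ m (leqnn m))] hm.
  by have [_ _] := hu m.
apply/nbhs_ballP; exists (k.+1%:R^-1) => /=; first by rewrite invr_gt0.
move=> v xv Wv.
have [w [Ww wv]] := W_approx Wv.
have wG := GW v w Wv Ww wv.
suff : `|G x - G v| <= e / 2.
  by move=> /le_lt_trans; apply; rewrite ltr_pdivrMr// ltr_pMr// ltr1n.
have cG : `|G x - G (w k)| @[k --> \oo] --> `|G x - G v|.
  by apply: cvg_norm; apply: cvgB => //; exact: cvg_cst.
rewrite -(cvg_lim _ cG)//; apply: limr_le; first by apply/cvg_ex; eexists; exact: cG.
have : \forall j \near \oo, ball x (k.+1%:R^-1) (w j).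
  by apply: wv; apply: open_nbhs_nbhs; split => //; exact: ball_open.
by apply: filterS => j /(xk _ (Ww j))/ltW.
Qed.

(** The criterion used for both kernels: outside the compact set of points of W
    with coordinates at most M, some coordinate exceeds M. *)
Lemma C_infty_W n (G : 'rV[R]_n -> R) :
  (forall x u, W x -> (forall k, Wint (u k)) -> u @ \oo --> x ->
    G (u k) @[k --> \oo] --> G x) ->
  (forall e, 0 < e -> exists M : R, forall x, Wint x -> (exists i, M < x ord0 i) ->
    `|G x| <= e) ->
  C_infty (@W R n) G.
Proof.
move=> GW Goo; split; first exact: continuous_W_of_Wint.
move=> e e0; have e20 : 0 < e / 2 by rewrite divr_gt0.
have [M HM] := Goo _ e20.
exists [set x : 'rV[R]_n | W x /\ forall i, x ord0 i <= M].
split; [exact: compact_W_le|by move=> x []|].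
move=> x Wx /not_andP[//|/existsNP[i /negP]]; rewrite -ltNge => Mx.
have [w [Ww wx]] := W_approx Wx.
suff : `|G x| <= e / 2.
  by move=> /le_lt_trans; apply; rewrite ltr_pdivrMr// ltr_pMr// ltr1n.
have cG : `|G (w k)| @[k --> \oo] --> `|G x|.
  by apply: cvg_norm; exact: GW.
rewrite -(cvg_lim _ cG)//; apply: limr_le; first by apply/cvg_ex; eexists; exact: cG.
have : \forall j \near \oo, M < w j ord0 i.
  by apply: (cvgr_gt (x ord0 i)) => //; move/cvg_rowP : wx; exact.
by apply: filterS => j Mj; apply: HM => //; exists i.
Qed.

End row_vectors.

Section measurability.
Context {R : realType}.

Definition Wtuple n : set (Rtuple R n) := @vec R n @^-1` @W R n.

Lemma WtupleP n (t : Rtuple R n) : Wtuple t <-> (forall i, 0 <= tnth t i :> R) /\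
  (forall i j : 'I_n, (i <= j)%N -> tnth t i <= tnth t j :> R).
Proof.
split=> -[h1 h2]; split.
- by move=> i; have := h1 i; rewrite mxE.
- by move=> i j ij; have := h2 i j ij; rewrite !mxE.
- by move=> i; rewrite mxE; exact: h1.
- by move=> i j ij; rewrite !mxE; exact: h2.
Qed.

Lemma measurable_Wtuple n : measurable (@Wtuple n).
Proof.
have -> : @Wtuple n =
    (\bigcap_(i in [set: 'I_n]) [set t : Rtuple R n | 0 <= tnth t i :> R]) `&`
    (\bigcap_(ij in [set ij : 'I_n * 'I_n | (ij.1 <= ij.2)%N])
       [set t : Rtuple R n | tnth t ij.1 <= tnth t ij.2 :> R]).
  apply/seteqP; split=> [t /WtupleP[h1 h2]|t [h1 h2]].
    by split=> [i _|[i j]/= ij]; [exact: h1|exact: h2].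
  by apply/WtupleP; split=> [i|i j ij]; [exact: h1|exact: (h2 (i, j))].
apply: measurableI; apply: fin_bigcap_measurable.
- exact: finite_finset.
- move=> i _; rewrite -[X in measurable X]setTI.
  apply: (@measurable_fun_le _ _ R setT (cst 0) (fun t : Rtuple R n => tnth t i : R)) => //.
  exact: measurable_tnth.
- exact: finite_finset.
- move=> ij _; rewrite -[X in measurable X]setTI.
  apply: (@measurable_fun_le _ _ R setT (fun t : Rtuple R n => tnth t ij.1 : R)
    (fun t : Rtuple R n => tnth t ij.2 : R)) => //.
    exact: measurable_tnth.
  exact: measurable_tnth.
Qed.

(** Rounding down to a grid is monotone and preserves 0, hence maps W to W, and
    takes countably many values on tuples. *)
Definition grid (m : nat) (x : R) : R := (Num.floor (x * m.+1%:R))%:~R / m.+1%:R.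

Lemma grid_le m x : grid m x <= x.
Proof. by rewrite ler_pdivrMr// floor_le. Qed.

Lemma grid_gt m x : x - m.+1%:R^-1 < grid m x.
Proof.
rewrite ltr_pdivlMr// mulrBl mulVf// ltrBlDr.
by have /andP[_] := floor_itv (x * m.+1%:R); rewrite intrD.
Qed.

Lemma grid_homo m x y : x <= y -> grid m x <= grid m y.
Proof. by move=> xy; rewrite ler_pM2r// ler_int le_floor// ler_pM2r. Qed.

Lemma cvg_grid x : grid m x @[m --> \oo] --> x.
Proof.
apply: (@squeeze_cvgr _ _ _ _ (fun m => x - m.+1%:R^-1) (fun=> x)).
- by apply: nearW => m; rewrite grid_le ltW// grid_gt.
- rewrite -[X in _ --> X]subr0; apply: cvgB; first exact: cvg_cst.
  exact: cvg_harmonic.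
- exact: cvg_cst.
Qed.

(** f is known to be continuous only along W. Composed with rounding it is
    measurable, as a function of a countable type, and it converges to f because
    rounding stays in W. *)
Lemma measurable_within_W n (f : 'rV[R]_n -> R) :
  {within @W R n, continuous f} ->
  measurable_fun (@Wtuple n) (fun t : Rtuple R n => f (vec t)).
Proof.
move=> cf.
pose fl m (t : Rtuple R n) : n.-tuple int := [tuple Num.floor ((tnth t i : R) * m.+1%:R) | i < n].
pose gr m (s : n.-tuple int) : 'rV[R]_n := \row_i ((tnth s i)%:~R / m.+1%:R).
apply: (@measurable_fun_cvg _ _ _ _ (fun m t => f (gr m (fl m t)))).
  move=> m; apply: measurable_funTS => _ Y mY; rewrite setTI.
  rewrite (_ : _ @^-1` Y = \bigcup_s
     (if pselect (Y (f (gr m s))) then fl m @^-1` [set s] else set0)); last first.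
    apply/seteqP; split=> [t /= Yt|t [s _]].
      by exists (fl m t) => //; case: pselect.
    by case: pselect => // Ys /= ->.
  apply: countable_bigcupT_measurable => [|s].
    exact: countableP.
  case: pselect => [Ys|nYs] /=; last exact: measurable0.
  pose A (i : 'I_n) : set (measurableTypeR R) :=
    `[((tnth s i)%:~R / m.+1%:R : R), ((tnth s i + 1)%:~R / m.+1%:R : R)[%classic.
  rewrite (_ : _ @^-1` _ = [set t : Rtuple R n | forall i, A i (tnth t i)]).
    by apply: measurable_box => i; exact: measurable_itv.
  have AE (t : Rtuple R n) i : A i (tnth t i) <-> Num.floor ((tnth t i : R) * m.+1%:R) = tnth s i.
    rewrite /A/= in_itv/= ler_pdivrMr// ltr_pdivlMr//; split.
      exact: floor_def.
    by move=> <-; exact: floor_itv.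
  apply/seteqP; split=> t /=.
    by move=> ts i; apply/AE; rewrite -ts tnth_mktuple.
  by move=> h; apply: eq_from_tnth => i; rewrite tnth_mktuple; apply/AE.
move=> t Wtt.
have grE m : gr m (fl m t) = \row_i grid m (tnth t i).
  by apply/rowP => i; rewrite !mxE tnth_mktuple.
under eq_fun do rewrite grE.
move/subspace_continuousP : cf => /(_ _ Wtt) cf.
have ct : (\row_i grid m (tnth t i)) @[m --> \oo] --> vec t.
  by apply/cvg_rowP => i; under eq_fun do rewrite mxE; rewrite mxE; exact: cvg_grid.
have [t0 tS] := (WtupleP t).1 Wtt.
have Wg m : W (\row_i grid m (tnth t i) : 'rV[R]_n).
  split=> [i|i j ij]; rewrite !mxE; last by rewrite grid_homo// tS.
  by rewrite divr_ge0// ler0z floor_ge0 mulr_ge0// t0.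
apply: (cvg_comp (fun m => \row_i grid m (tnth t i)) f _ cf).
move=> V hV.
have : \forall m \near \oo, W (\row_i grid m (tnth t i) : 'rV[R]_n) ->
    V (\row_i grid m (tnth t i)) by exact: (ct _ hV).
by apply: filterS => m; apply; exact: Wg.
Qed.

End measurability.

(** * Normalised cell integrals preserve C_infty *)

Section C_infty_functions.
Context {R : realType}.

Lemma C_infty_bound n (f : 'rV[R]_n -> R) : C_infty (@W R n) f ->
  exists2 C, 0 <= C & forall y, W y -> `|f y| <= C.
Proof.
move=> [cf /(_ 1 ltr01)[K [cK KW Ksmall]]].
have cfK : {within K, continuous f} by exact: continuous_subspaceW cf.
have [M [_ HM]] := compact_bounded (continuous_compact cfK cK).
exists (`|M| + 1); first by rewrite addr_ge0.
move=> y Wy; case: (pselect (K y)) => Ky.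
  apply: (HM (`|M| + 1)); last by exists y.
  by rewrite (le_lt_trans (ler_norm M))// ltrDl.
by rewrite (le_trans (ltW (Ksmall y Wy Ky)))// lerDr.
Qed.

Lemma decay_ge0 q (c : R) n (t : Rtuple R n) : 0 <= decay q c t.
Proof. by rewrite prodr_ge0// => i _; rewrite powR_ge0. Qed.

(** Outside a compact set |f| is below e, and on a compact set the decaying
    function is bounded below by a positive constant. *)
Lemma C_infty_le_decay n (f : 'rV[R]_n -> R) q e : 0 <= q -> 0 < e ->
  C_infty (@W R n) f ->
  exists2 C, 0 <= C & forall t : Rtuple R n, Wtuple t -> `|f (vec t)| <= e + C * decay q 1 t.
Proof.
move=> q0 e0 Cf; have [C C0 fC] := C_infty_bound Cf.
have [_ /(_ e e0)[K [cK KW Ksmall]]] := Cf.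
have [M [_ HM]] := compact_bounded cK.
pose m0 := \prod_(i < n) (1 + (`|M| + 1)) `^ (- q).
have powM b : 0 < (1 + (`|M| + 1)) `^ b by rewrite powR_gt0// ltr_pwDl// addr_ge0.
have m00 : 0 < m0 by rewrite prodr_gt0.
exists (C / m0); first by rewrite divr_ge0// ltW.
move=> t Wtt; case: (pselect (K (vec t))) => Kt; last first.
  rewrite (le_trans (ltW (Ksmall _ Wtt Kt)))// lerDl mulr_ge0//.
    by rewrite divr_ge0// ltW.
  exact: decay_ge0.
rewrite (le_trans (fC _ Wtt))// (@le_trans _ _ (C / m0 * decay q 1 t))//; last first.
  by rewrite lerDr ltW.
rewrite -mulrA ler_peMr// [m0^-1 * _]mulrC ler_pdivlMr// mul1r.
have [t0 _] := (WtupleP t).1 Wtt.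
apply: ler_prod => i _; rewrite powR_ge0/= !powRN lef_pV2 ?posrE.
- apply: ge0_ler_powR => //; rewrite ?nnegrE ?mul1r.
  + by rewrite addr_ge0.
  + by rewrite addr_ge0// addr_ge0.
  rewrite lerD2l.
  have := HM (`|M| + 1); have -> : M < `|M| + 1.
    by rewrite (le_lt_trans (ler_norm M))// ltrDl.
  move=> /(_ isT _ Kt) /=; apply: le_trans.
  by have := coord_le_norm (vec t) i; rewrite mxE; apply: le_trans; exact: ler_norm.
- exact: powM.
- by rewrite powR_gt0// mul1r ltr_pwDl.
Qed.

(** Extension by 0 from W, so that integrals over W become integrals over all
    tuples against a measurable function. *)
Definition ext n (f : 'rV[R]_n -> R) : Rtuple R n -> R := (fun t => f (vec t)) \_ (@Wtuple R n).

Lemma measurable_ext n (f : 'rV[R]_n -> R) : C_infty (@W R n) f ->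
  measurable_fun [set: Rtuple R n] (ext f).
Proof.
move=> [cf _]; have h := @measurable_restrictT _ _ (Rtuple R n) R (@Wtuple R n) (fun t => f (vec t)) (@measurable_Wtuple R n).
by apply/h; exact: measurable_within_W.
Qed.

Lemma ext_W n (f : 'rV[R]_n -> R) (t : Rtuple R n) : Wtuple t -> ext f t = f (vec t).
Proof. by move=> Wtt; rewrite /ext patchE mem_set. Qed.

Lemma ext_bound n (f : 'rV[R]_n -> R) C : 0 <= C -> (forall y, W y -> `|f y| <= C) ->
  forall t, `|ext f t| <= C.
Proof.
move=> C0 fC t; rewrite /ext patchE; case: ifPn => [/[!inE]|_]; first exact: fC.
by rewrite normr0.
Qed.

End C_infty_functions.

(** Hypotheses on a normalised cell integral with nodes [e x] under which it
    preserves C_infty. The last one is the exact evaluation: at c = 0 it says that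
    the kernel has mass 1, and at c = 1 that the image of a decaying function
    decays. *)
Section kernels.
Context {R : realType}.
Variables (a : R) (n m : nat) (e : 'rV[R]_m -> nat -> R) (Z : 'rV[R]_m -> R) (r : R).
Hypotheses (a1 : -1 < a) (r0 : 0 < r).
Hypothesis e_nodes : forall x, Wint x -> nodes n (e x).
Hypothesis e_cvg : forall x u, Wint x -> u @ \oo --> x ->
  forall i, (i <= n)%N -> e (u k) i @[k --> \oo] --> e x i.
Hypothesis Z_ge0 : forall x, Wint x -> 0 <= Z x.
Hypothesis Z_cvg : forall x u, Wint x -> u @ \oo --> x -> Z (u k) @[k --> \oo] --> Z x.
Hypothesis Z_decay : forall x c, Wint x -> 0 <= c ->
  Z x * cell_integral a (e x) (@decay R (a + n%:R + 1) c n) =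
  \prod_(i < m) (1 + c * x ord0 i) `^ (- r).

Let q := a + n%:R + 1.
Let q0 : 0 <= q.
Proof. by rewrite /q; have := ler0n R n; move: a1; lra. Qed.

Let op (g : Rtuple R n -> R) x := Z x * cell_integral a (e x) g.

Let mass1 x : Wint x -> op (fun=> 1) x = 1.
Proof.
move=> Wx; have := Z_decay Wx (lexx 0).
have -> : @decay R (a + n%:R + 1) 0 n = (fun=> 1) by apply/funext => t; rewrite decay0.
by rewrite /op => ->; rewrite big1// => i _; rewrite mul0r addr0 powR1.
Qed.

Lemma kernel_bound (g : Rtuple R n -> R) C x : Wint x -> measurable_fun setT g ->
  (forall t, `|g t| <= C) -> `|op g x| <= C.
Proof.
move=> Wx mg gC; have nx := e_nodes Wx.
rewrite /op normrM (ger0_norm (Z_ge0 Wx)).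
rewrite -[leRHS]mulr1 -(mass1 Wx) /op mulrCA ler_wpM2l ?Z_ge0//.
exact: cell_integral_bound.
Qed.

(** |f| is at most a small constant plus a multiple of [decay q 1]. The kernel
    preserves the constant and maps the decaying function to one that is at most
    (1 + M)^(-r) as soon as some coordinate exceeds M. *)
Lemma kernel_vanish (f : 'rV[R]_n -> R) : C_infty (@W R n) f ->
  forall d, 0 < d -> exists M : R, forall x, Wint x -> (exists i, M < x ord0 i) ->
    `|op (ext f) x| <= d.
Proof.
move=> Cf d d0; have d20 : 0 < d / 2 by rewrite divr_gt0.
have [C C0 fC] := C_infty_le_decay q0 d20 Cf.
have [B B0 fB] := C_infty_bound Cf.
have [M M0 HM] : exists2 M : R, 0 <= M & C * (1 + M) `^ (- r) <= d / 2.
  (* chosen so that M ^ r = (C + 1) / (d / 2) *)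
  exists (((C + 1) / (d / 2)) `^ r^-1); first exact: powR_ge0.
  have K0 : 0 < (C + 1) / (d / 2) by rewrite divr_gt0// ltr_wpDl.
  apply: (@le_trans _ _ (C * ((C + 1) / (d / 2))^-1)).
    rewrite ler_wpM2l// powRN lef_pV2 ?posrE ?powR_gt0// ?ltr_pwDl ?powR_ge0//.
    apply: (@le_trans _ _ ((((C + 1) / (d / 2)) `^ r^-1) `^ r)).
      by rewrite -powRrM mulVf ?lt0r_neq0// powRr1// ltW.
    by apply: ge0_ler_powR; rewrite ?nnegrE ?addr_ge0 ?powR_ge0 ?lerDr ?ltW.
  rewrite invf_div mulrCA; apply: ler_piMr; first exact: ltW.
  by rewrite ler_pdivrMr ?ltr_wpDl// mul1r lerDl.
exists M => x Wx [i Mx]; have nx := e_nodes Wx.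
have decayi : op (@decay R q 1 n) x <= (1 + M) `^ (- r).
  rewrite /op Z_decay// (bigD1 i)//= mul1r.
  rewrite -[leRHS]mulr1 ler_pM// ?prodr_ge0// ?powR_ge0//.
  - by move=> j _; rewrite powR_ge0.
  - have xi0 := Wx.1 i; have p1 : 0 < 1 + x ord0 i by rewrite addr_gt0.
    have p2 : 0 < 1 + M by rewrite ltr_pwDl.
    rewrite !powRN lef_pV2 ?posrE ?powR_gt0//.
    apply: ge0_ler_powR; rewrite ?nnegrE ?(ltW p1) ?(ltW p2) ?(ltW r0)//.
    by rewrite lerD2l ltW.
  - apply: prodr_ile1 => j _; rewrite powR_ge0/= powRN mul1r.
    have h : 1 <= 1 + x ord0 j by rewrite lerDl ltW// Wx.1.
    rewrite invf_le1 ?powR_gt0 ?(lt_le_trans _ h)//.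
    have e1 : 1 `^ r = 1 :> R by rewrite powR1.
    rewrite -[leLHS]e1; apply: ge0_ler_powR; rewrite ?nnegrE ?ler01 ?(le_trans _ h)//.
    exact: ltW.
have intD : weight_integrable a (e x) (@decay R q 1 n).
  exact: (integral_weight_decay_det a1 ler01 nx).1.
have intf : weight_integrable a (e x) (ext f).
  exact: (integrable_weightM a1 nx (measurable_ext Cf) (ext_bound B0 fB)).
have h t : (forall i, 0 <= (tnth t i : R)) -> `|ext f t| <= d / 2 + C * decay q 1 t.
  move=> t0; case: (pselect (Wtuple t)) => Wtt; first by rewrite ext_W// fC.
  rewrite /ext patchE memNset// normr0; apply: addr_ge0; first exact: ltW.
  by apply: mulr_ge0 => //; exact: decay_ge0.
have [i1 e1] := cell_integral_affine (- (d / 2)) (- C) a1 nx intD.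
have [i2 e2] := cell_integral_affine (d / 2) C a1 nx intD.
have upper : Z x * (d / 2 * cell_integral a (e x) (fun _ : Rtuple R n => 1) +
    C * cell_integral a (e x) (@decay R q 1 n)) <= d.
  rewrite mulrDr mulrCA [X in _ + X]mulrCA.
  have := mass1 Wx; rewrite /op => ->; rewrite mulr1.
  rewrite [leRHS](splitr d) lerD2l (le_trans _ HM)//.
  by rewrite ler_wpM2l.
rewrite /op normrM (ger0_norm (Z_ge0 Wx)) (le_trans _ upper)// ler_wpM2l ?Z_ge0//.
rewrite ler_norml; apply/andP; split.
  rewrite opprD -(mulNr (d / 2)) -(mulNr C) -e1; apply: cell_integral_le => // t t0.
  by have := h t t0; rewrite ler_norml => /andP[+ _]; rewrite opprD mulNr.
rewrite -e2; apply: cell_integral_le => // t t0.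
by have := h t t0; rewrite ler_norml => /andP[].
Qed.

Lemma kernel_cvg (g : Rtuple R n -> R) C x u : Wint x -> (forall k, Wint (u k)) ->
  u @ \oo --> x -> measurable_fun setT g -> (forall t, `|g t| <= C) ->
  op g (u k) @[k --> \oo] --> op g x.
Proof.
move=> Wx Wu ux mg gC; apply: cvgM; first exact: Z_cvg.
apply: (@cvg_cell_integral _ _ _ _ _ _ C) => //.
- by move=> k; exact: e_nodes.
- exact: e_nodes.
- exact: e_cvg.
Qed.

Lemma kernel_C_infty (f : 'rV[R]_n -> R) (G : 'rV[R]_m -> R) :
  C_infty (@W R n) f ->
  (forall x, Wint x -> G x = Z x * cell_integral a (e x) (ext f)) ->
  (forall x u, W x -> ~ Wint x -> (forall k, Wint (u k)) -> u @ \oo --> x ->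
    G (u k) @[k --> \oo] --> G x) ->
  C_infty (@W R m) G.
Proof.
move=> Cf GE Gb; have [B B0 fB] := C_infty_bound Cf.
apply: C_infty_W.
  move=> x u Wx Wu ux; case: (pselect (Wint x)) => Wix; last exact: Gb.
  rewrite GE//; under eq_fun do rewrite GE//.
  apply: (@kernel_cvg _ B) => //; first exact: measurable_ext.
  exact: ext_bound.
move=> d d0; have [M HM] := kernel_vanish Cf d0.
by exists M => x Wx Mx; rewrite GE// HM.
Qed.

End kernels.

(** * The kernel of equal dimensions *)

Section weak_extension_facts.
Context {R : realType}.

Lemma integral_density d (T : measurableType d) (m v : {measure set T -> \bar R})
    (D : set T) (k f : T -> R) :
  measurable D -> measurable_fun D k -> (forall x, D x -> 0 <= k x) ->
  (forall A, measurable A -> v A = \int[m]_(x in A `&` D) (k x)%:E)%E ->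
  measurable_fun D f ->
  (\int[v]_(x in D) (f x)%:E = \int[m]_(x in D) (f x * k x)%:E)%E.
Proof.
move=> mD mk k0 vE mf; rewrite integralE [in RHS]integralE.
rewrite funerpos funerneg (funerpos (fun x => f x * k x)) (funerneg (fun x => f x * k x)).
rewrite (@ge0_integral_density _ _ _ m v D k (f^\+))//; last exact: measurable_funrpos.
rewrite (@ge0_integral_density _ _ _ m v D k (f^\-))//; last exact: measurable_funrneg.
congr (_ - _)%E; apply: eq_integral => x /[!inE] Dx; congr (_%:E).
  by rewrite /funrpos /= maxr_pMl ?k0// mul0r.
by rewrite /funrneg /= maxr_pMl ?k0// mul0r mulNr.
Qed.

Lemma integral_kernel_density n (v : {measure set (Rtuple R n) -> \bar R})
    (k : Rtuple R n -> R) (f : 'rV[R]_n -> R) :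
  C_infty (@W R n) f -> measurable_fun setT k -> (forall t, 0 <= k t) ->
  (forall A : set (Rtuple R n), measurable A ->
     v A = \int[leb R n]_(t in A `&` @Wtuple R n) (k t)%:E)%E ->
  (leb R n).-integrable setT (fun t => (k t * ext f t)%:E) ->
  (\int[v]_(t in @Wtuple R n) (f (vec t))%:E =
   (\int[leb R n]_t (k t * ext f t))%:E)%E.
Proof.
move=> Cf mk k0 vE int.
rewrite (@integral_density _ _ (leb R n) v (@Wtuple R n) k (fun t => f (vec t)))//.
- rewrite /Rintegral fineK; last exact: integrable_fin_num.
  rewrite integral_mkcond; apply: eq_integral => t _.
  by rewrite /ext !patchE; case: ifPn => _; rewrite ?mulr0// mulrC.
- exact: measurable_Wtuple.
- exact: measurable_funTS.
- exact: measurable_within_W Cf.1.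
Qed.

(** The defining property of a weak extension gives the convergence of the
    extended real integrals; the uniform bound B makes the limit finite, so that
    it is also the limit of the real values. *)
Lemma weak_extension_cvg m n (dens : 'rV[R]_m -> 'rV[R]_n -> R)
    (L : 'rV[R]_m -> {measure set (Rtuple R n) -> \bar R}) (f : 'rV[R]_n -> R) B :
  weak_extension dens L -> C_infty (@W R n) f ->
  (forall x, Wint x ->
    (\int[L x]_(t in @Wtuple R n) (f (vec t))%:E = (kernel_op L f x)%:E)%E) ->
  (forall x, Wint x -> `|kernel_op L f x| <= B) ->
  forall x u, W x -> ~ Wint x -> (forall k, Wint (u k)) -> u @ \oo --> x ->
    kernel_op L f (u k) @[k --> \oo] --> kernel_op L f x.
Proof.
move=> [_ wL] Cf Lfin LB x u Wx nWx Wu ux.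
have [C C0 fC] := C_infty_bound Cf.
have bf : [bounded f y | y in @W R n].
  exists C; split; first exact: num_real.
  by move=> M CM y Wy; rewrite /= (le_trans (fC _ Wy))// ltW.
have := (wL x Wx nWx).2 u Wu ux f Cf.1 bf.
under eq_fun do rewrite (Lfin _ (Wu _)).
rewrite /kernel_op /Rintegral -/(@Wtuple R n).
set l := (\int[L x]_(t in _) _)%E => ul.
have lB : (l <= B%:E)%E.
  apply: (cvge_le _ ul); apply: nearW => k; rewrite lee_fin.
  by have := LB _ (Wu k); rewrite ler_norml => /andP[].
have Bl : ((- B)%:E <= l)%E.
  apply: (cvge_ge _ ul); apply: nearW => k; rewrite lee_fin.
  by have := LB _ (Wu k); rewrite ler_norml => /andP[].
have lfin : l \is a fin_num.
  rewrite fin_numE; apply/andP; split.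
    by apply/eqP => lE; move: Bl; rewrite lE.
  by apply/eqP => lE; move: lB; rewrite lE.
by move: ul; rewrite -[X in _ --> X](fineK lfin) => /fine_cvg.
Qed.

Lemma cvg_prod_seq (I : Type) (s : seq I) (P : pred I) (F : I -> nat -> R) (l : I -> R) :
  (forall i, P i -> F i k @[k --> \oo] --> l i) ->
  \prod_(i <- s | P i) F i k @[k --> \oo] --> \prod_(i <- s | P i) l i.
Proof.
by move=> Fl; apply: (cvg_big (@mul_continuous R)).
Qed.

Lemma cvg_powR (u : nat -> R) (l b : R) : 0 < l -> u @ \oo --> l ->
  u k `^ b @[k --> \oo] --> l `^ b.
Proof.
move=> l0 ul; apply: (cvg_comp u (fun x => x `^ b) ul).
have h := @is_derive1_powR R b l l0.
have : derivable (fun x : R => x `^ b) l 1 by exact: ex_derive.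
by move=> /derivable1_diffP/differentiable_continuous.
Qed.

Lemma cvg_vandermonde n (u : nat -> 'rV[R]_n) x : u @ \oo --> x ->
  vandermonde (u k) @[k --> \oo] --> vandermonde x.
Proof.
move/cvg_rowP => ux; apply: cvg_prod_seq => i _; apply: cvg_prod_seq => j _.
by apply: cvgB; exact: ux.
Qed.

Lemma vandermonde_gt0 n (x : 'rV[R]_n) : Wint x -> 0 < vandermonde x.
Proof.
move=> [_ xS]; apply: prodr_gt0 => i _; apply: prodr_gt0 => j ij.
by rewrite subr_gt0 xS.
Qed.

Lemma coordS n (x : 'rV[R]_n) (i : 'I_n) : coord x i.+1 = x ord0 i.
Proof. by rewrite /coord valK. Qed.

Lemma cvg_coord n (u : nat -> 'rV[R]_n) x k : u @ \oo --> x ->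
  coord (u j) k @[j --> \oo] --> coord x k.
Proof.
move=> /cvg_rowP ux; case: k => [|k]; first exact: cvg_cst.
by rewrite /coord; case: insubP => [i _ _|_] /=; [exact: ux|exact: cvg_cst].
Qed.

Lemma coord_leS n (x : 'rV[R]_n) k : W x -> (k < n)%N -> coord x k <= coord x k.+1.
Proof.
move=> [x0 xS] kn; rewrite (@coordS n x (Ordinal kn)).
case: k kn => [|k] kn; first exact: x0.
rewrite (@coordS n x (Ordinal (ltnW kn))); exact: xS.
Qed.

Lemma nodes_coord n (x : 'rV[R]_n) : W x -> nodes n (coord x).
Proof. by move=> Wx; split=> // i; exact: coord_leS. Qed.

Lemma nodes_coordS n (x : 'rV[R]_n.+1) : W x -> nodes n (fun k => coord x k.+1).
Proof.
move=> Wx; split=> [|i ni]; last by exact: coord_leS.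
by rewrite (@coordS _ x ord0) Wx.1.
Qed.

End weak_extension_facts.

Section equal_dimensions.
Context {R : realType}.
Variables (a : R) (n : nat).
Hypotheses (a1 : -1 < a) (n0 : (0 < n)%N).

Definition norm_NN (z : 'rV[R]_n) : R :=
  poch (a + 1) n / ((\prod_(i < n) z ord0 i `^ (a + 1)) * vandermonde z).

Lemma poch_gt0 (b : R) k : 0 < b -> 0 < poch b k.
Proof. by move=> b0; apply: prodr_gt0 => i _; rewrite ltr_wpDr. Qed.

Let poch0 : 0 < poch (a + 1) n.
Proof. by apply: poch_gt0; move: a1; lra. Qed.

Let prod0 (z : 'rV[R]_n) : Wint z -> 0 < \prod_(i < n) z ord0 i `^ (a + 1).
Proof. by move=> Wz; apply: prodr_gt0 => i _; rewrite powR_gt0// Wz.1. Qed.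

Lemma norm_NN_gt0 (z : 'rV[R]_n) : Wint z -> 0 < norm_NN z.
Proof. by move=> Wz; rewrite divr_gt0// mulr_gt0 ?prod0 ?vandermonde_gt0. Qed.

Lemma norm_NN_cvg (z : 'rV[R]_n) u : Wint z -> u @ \oo --> z ->
  norm_NN (u k) @[k --> \oo] --> norm_NN z.
Proof.
move=> Wz uz; apply: cvgM; first exact: cvg_cst.
apply: cvgV; first by rewrite mulf_neq0// lt0r_neq0 ?prod0 ?vandermonde_gt0.
apply: cvgM; last exact: cvg_vandermonde.
apply: cvg_prod_seq => i _; apply: cvg_powR; first exact: Wz.1.
by move/cvg_rowP : uz; exact.
Qed.

Lemma norm_NN_decay (z : 'rV[R]_n) c : Wint z -> 0 <= c ->
  norm_NN z * cell_integral a (coord z) (@decay R (a + n%:R + 1) c n) =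
  \prod_(i < n) (1 + c * z ord0 i) `^ (- (a + n%:R)).
Proof.
move=> Wz c0.
rewrite /cell_integral (@integral_weight_decay_NN _ a c n)//; last first.
  exact/nodes_coord/Wint_W.
have -> : \prod_(i < n) coord z i.+1 `^ (a + 1) = \prod_(i < n) z ord0 i `^ (a + 1).
  by apply: eq_bigr => i _; rewrite coordS.
have -> : \prod_(i < n) (1 + c * coord z i.+1) `^ (- (a + n%:R)) =
    \prod_(i < n) (1 + c * z ord0 i) `^ (- (a + n%:R)).
  by apply: eq_bigr => i _; rewrite coordS.
have -> : \prod_(i < n) \prod_(j < n | (i < j)%N) (coord z j.+1 - coord z i.+1) =
    vandermonde z.
  by apply: eq_bigr => i _; apply: eq_bigr => j _; rewrite !coordS.
have h1 := lt0r_neq0 poch0; have h2 := lt0r_neq0 (prod0 Wz).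
have h3 := lt0r_neq0 (vandermonde_gt0 Wz).
by rewrite /norm_NN; field; rewrite h1 h2 h3.
Qed.

(** Interlacing with z places the coordinates of t between consecutive nodes of
    the sequence 0, z_1, ..., z_n. *)
Lemma density_NNE (z : 'rV[R]_n) (t : Rtuple R n) : Wint z -> Wtuple t ->
  density_NN a z (vec t) = norm_NN z * weight a (coord z) t.
Proof.
move=> Wz Wtt; rewrite /density_NN.
rewrite big_add1 big_mkord.
rewrite (eq_bigr (fun i : 'I_n => (tnth t i : R) `^ a * (z ord0 i `^ (a + 1))^-1)); last first.
  by move=> i _; rewrite !coordS mxE.
rewrite big_split/= prodfV.
case: (pselect (forall i : 'I_n, coord z i <= tnth t i <= coord z i.+1)) => h.
  rewrite weight_in// indicE mem_set ?mulr1; last first.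
    split => // -[//|k] /andP[_ kn].
    by have := h (Ordinal kn); rewrite (@coordS _ _ (vec t) (Ordinal kn)) mxE.
  by rewrite /norm_NN invfM; ring.
rewrite weight_out// indicE memNset ?mulr0// => -[_ hk]; apply: h => i.
by have := hk i.+1 (ltn_ord i); rewrite (coordS (vec t)) mxE.
Qed.

Variable L : 'rV[R]_n -> {measure set (Rtuple R n) -> \bar R}.
Hypothesis LP : is_Lambda_NN a L.
Variable f : 'rV[R]_n -> R.
Hypothesis Cf : C_infty (@W R n) f.

Let nodesz (z : 'rV[R]_n) : Wint z -> nodes n (coord z).
Proof. by move=> Wz; exact/nodes_coord/Wint_W. Qed.

Lemma integral_NN (z : 'rV[R]_n) : Wint z ->
  (\int[L z]_(t in @Wtuple R n) (f (vec t))%:E =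
   (norm_NN z * cell_integral a (coord z) (ext f))%:E)%E.
Proof.
move=> Wz; have [B B0 fB] := C_infty_bound Cf.
have intw : (leb R n).-integrable setT (EFin \o (fun t => weight a (coord z) t * ext f t)).
  exact: (integrable_weightM a1 (nodesz Wz) (measurable_ext Cf) (ext_bound B0 fB)).
rewrite (@integral_kernel_density _ n (L z) (fun t => norm_NN z * weight a (coord z) t))//.
- rewrite /cell_integral -RintegralZl//; congr (_%:E); apply: eq_Rintegral => t _.
  by rewrite mulrA.
- by apply: measurable_funM => //; exact: measurable_weight.
- by move=> t; apply: mulr_ge0; [exact/ltW/norm_NN_gt0|exact/weight_ge0/nodesz].
- move=> A mA; rewrite LP.1//; apply: eq_integral => t; rewrite inE => -[_ Wtt].
  by rewrite density_NNE.
- under eq_fun do rewrite -mulrA.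
  exact: (integrableZl measurableT (norm_NN z) intw).
Qed.

Lemma kernel_NN (z : 'rV[R]_n) : Wint z ->
  kernel_op L f z = norm_NN z * cell_integral a (coord z) (ext f).
Proof. by move=> Wz; rewrite /kernel_op /Rintegral integral_NN. Qed.

Lemma C_infty_NN : C_infty (@W R n) (kernel_op L f).
Proof.
have [B B0 fB] := C_infty_bound Cf.
have r0 : 0 < a + n%:R.
  have : 1 <= n%:R :> R by rewrite ler1n.
  by move: a1; lra.
apply: (@kernel_C_infty R a n n (@coord R n) norm_NN (a + n%:R) a1 r0 _ _ _ _ _ f) => //.
- by move=> x u Wx ux i _; exact: cvg_coord.
- by move=> z Wz; exact/ltW/norm_NN_gt0.
- exact: norm_NN_cvg.
- exact: norm_NN_decay.
- exact: kernel_NN.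
- apply: (@weak_extension_cvg _ _ _ _ L f B LP Cf) => x Wx.
    by rewrite integral_NN// kernel_NN.
  rewrite kernel_NN//.
  apply: (@kernel_bound R a n n (@coord R n) norm_NN (a + n%:R)) => //.
  + by move=> z Wz; exact/ltW/norm_NN_gt0.
  + exact: norm_NN_decay.
  + exact: measurable_ext.
  + exact: ext_bound.
Qed.

End equal_dimensions.

(** * The kernel lowering the dimension *)

Section lowered_dimension.
Context {R : realType}.
Variables (a : R) (n : nat).
Hypotheses (a1 : -1 < a) (n0 : (0 < n)%N).
Local Notation mu := (@lebesgue_measure R).

Definition shift_nodes (x : 'rV[R]_n.+1) (k : nat) : R := coord x k.+1.

Definition norm_SN (x : 'rV[R]_n.+1) : R := poch 1 n / vandermonde x.

Lemma poch1 : poch (1 : R) n = n`!%:R.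
Proof.
rewrite /poch big_mkord; elim: n => [|k IH]; first by rewrite big_ord0 fact0.
by rewrite big_ord_recr/= IH factS natrM mulrC -natr1 addrC.
Qed.

Lemma norm_SN_gt0 (x : 'rV[R]_n.+1) : Wint x -> 0 < norm_SN x.
Proof. by move=> Wx; rewrite divr_gt0 ?poch_gt0 ?vandermonde_gt0. Qed.

Lemma norm_SN_cvg (x : 'rV[R]_n.+1) u : Wint x -> u @ \oo --> x ->
  norm_SN (u k) @[k --> \oo] --> norm_SN x.
Proof.
move=> Wx ux; apply: cvgM; first exact: cvg_cst.
apply: cvgV; first by rewrite lt0r_neq0 ?vandermonde_gt0.
exact: cvg_vandermonde.
Qed.

Lemma norm_SN_decay (x : 'rV[R]_n.+1) c : Wint x -> 0 <= c ->
  norm_SN x * cell_integral 0 (shift_nodes x) (@decay R (0 + n%:R + 1) c n) =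
  \prod_(i < n.+1) (1 + c * x ord0 i) `^ (- n%:R).
Proof.
move=> Wx c0; rewrite add0r /cell_integral integral_weight_decay_SN//; last first.
  exact/nodes_coordS/Wint_W.
have -> : \prod_(i < n.+1) (1 + c * shift_nodes x i) `^ (- n%:R) =
    \prod_(i < n.+1) (1 + c * x ord0 i) `^ (- n%:R).
  by apply: eq_bigr => i _; rewrite /shift_nodes coordS.
have -> : \prod_(i < n.+1) \prod_(j < n.+1 | (i < j)%N)
    (shift_nodes x j - shift_nodes x i) = vandermonde x.
  by apply: eq_bigr => i _; apply: eq_bigr => j _; rewrite /shift_nodes !coordS.
have h1 := lt0r_neq0 (@poch_gt0 R 1 n ltr01).
have h2 := lt0r_neq0 (vandermonde_gt0 Wx).
by rewrite /norm_SN; field; rewrite h1 h2.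
Qed.

Definition gap (x : 'rV[R]_n.+1) (t : Rtuple R n) (i : 'I_n) : set R :=
  `[Num.max (coord x i.+1) (tnth t i), upper_end x (vec t) i.+1]%classic.

Lemma gapP x t (s : R) (i : 'I_n) : gap x t i s <->
  [/\ coord x i.+1 <= s, s <= coord x i.+2, tnth t i <= s &
     (i.+1 < n)%N -> s <= coord (vec t) i.+2].
Proof.
rewrite /gap/= in_itv/= ge_max /upper_end; case: ifP => h.
  rewrite le_min; split=> [/andP[/andP[-> ->] /andP[-> ->]]//|[-> -> -> H]].
  by rewrite H.
by split=> [/andP[/andP[-> ->] ->]//|[-> -> -> _]].
Qed.

(** The integrand of the k-th inner integral of the density, on the interval over
    which it is integrated; its variable is the k-th coordinate of the
    intermediate point s. *)
Definition gap_density x t i (s : R) : R :=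
  \1_(gap x t i) s * ((tnth t i : R) `^ a * (s `^ (a + 1))^-1).

Lemma gap_density_ge0 x t i s : 0 <= gap_density x t i s.
Proof. by rewrite mulr_ge0// divr_ge0 ?powR_ge0. Qed.

Lemma measurable_gap_density x t i : measurable_fun setT (gap_density x t i).
Proof.
apply: measurable_funM.
  by apply: measurable_indic; exact: measurable_itv.
apply: measurable_funM => //.
exact: (measurableT_comp measurable_inv (measurable_powR _)).
Qed.

Lemma integral_gap_density_lty x t i : Wint x ->
  (\int[mu]_s (gap_density x t i s)%:E < +oo)%E.
Proof.
move=> Wx; have p0 : 0 < coord x i.+1.
  by rewrite (@coordS _ _ x (widen_ord (leqnSn n) i)) Wx.1.
pose M := (tnth t i : R) `^ a * (coord x i.+1 `^ (a + 1))^-1.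
apply: (@le_lt_trans _ _ (\int[mu]_(s in `[coord x i.+1, coord x i.+2]) M%:E)%E).
  rewrite [leRHS]integral_mkcond; apply: ge0_le_integral => //.
  - by move=> s _; rewrite lee_fin gap_density_ge0.
  - by apply/measurable_EFinP; exact: measurable_gap_density.
  - apply/(measurable_restrictT (cst M%:E) (measurable_itv _)) => //.
  move=> s _; rewrite patchE /gap_density indicE; case: (boolP (s \in gap _ _ _)) => sJ.
    move: sJ; rewrite inE => /gapP[h1 h2 _ _].
    rewrite mem_set/= ?in_itv/= ?h1 ?h2// mul1r lee_fin ler_wpM2l ?powR_ge0//.
    rewrite lef_pV2 ?posrE ?powR_gt0 ?(lt_le_trans p0)//.
    apply: ge0_ler_powR => //; rewrite ?nnegrE ?(le_trans _ h1) ?ltW//.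
    by move: a1; lra.
  rewrite mul0r; case: ifPn => // _; rewrite lee_fin mulr_ge0 ?invr_ge0 ?powR_ge0//.
rewrite integral_cst//= lebesgue_measure_itv/=.
by case: ifP => _; rewrite ?mule0 ?ltry// -EFinB -EFinM ltry.
Qed.

Definition cell_factor x (s : Rtuple R n) : R :=
  \prod_(i < n) (\1_(`[shift_nodes x i, shift_nodes x i.+1]) (tnth s i : R) *
     ((tnth s i : R) `^ (a + 1))^-1).

(** The joint density, up to constants, of the intermediate point s, which
    interlaces with x, and of the final point t, distributed under the kernel of
    equal dimensions at s. *)
Definition joint x (t s : Rtuple R n) : R :=
  cell_factor x s * (\1_(@Wtuple R n) t * weight a (coord (vec s)) t).

Lemma coord_vec (t : Rtuple R n) (i : 'I_n) : coord (vec t) i.+1 = tnth t i.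
Proof. by rewrite coordS mxE. Qed.

(** Both sides vanish unless s interlaces with x and t with s. The inequality
    between coordinate i.+1 of t and coordinate i of s is read from the i-th gap
    on the left and from the (i.+1)-st cell on the right. *)
Lemma prod_gap_density x (t s : Rtuple R n) : Wtuple t ->
  vandermonde (vec t) * \prod_(i < n) gap_density x t i (tnth s i) = joint x t s.
Proof.
move=> Wtt; rewrite /joint indicE mem_set// mul1r /cell_factor.
have iff : (forall i : 'I_n, gap x t i (tnth s i)) <->
    (forall i : 'I_n, shift_nodes x i <= tnth s i <= shift_nodes x i.+1) /\
    (forall i : 'I_n, coord (vec s) i <= tnth t i <= coord (vec s) i.+1).
  split=> [h|[h1 h2] i].
    split=> i; have /gapP[g1 g2 g3 g4] := h i; first by rewrite g1.
    rewrite coord_vec g3 andbT.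
    case: i {g1 g2 g3 g4} => -[|k] kn; first exact: ((WtupleP t).1 Wtt).1.
    have /gapP[_ _ _ /(_ kn)] := h (Ordinal (ltnW kn)).
    by rewrite (coord_vec s (Ordinal (ltnW kn))) (coord_vec t (Ordinal kn)).
  apply/gapP; have /andP[g1 g2] := h1 i; have /andP[_] := h2 i.
  rewrite coord_vec => g3; split => // kn.
  have /andP[+ _] := h2 (Ordinal kn).
  have -> : coord (vec s) (Ordinal kn) = tnth s i := coord_vec s i.
  by rewrite (coord_vec t (Ordinal kn)).
case: (pselect (forall i : 'I_n, gap x t i (tnth s i))) => h; last first.
  have -> : \prod_(i < n) gap_density x t i (tnth s i) = 0.
    have /existsNP[i hi] := h.
    by rewrite (bigD1 i)//= /gap_density indicE memNset// !mul0r.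
  case: (pselect (forall i : 'I_n, coord (vec s) i <= tnth t i <= coord (vec s) i.+1)) => h2.
    have /existsNP[i hi] : ~ (forall i : 'I_n, shift_nodes x i <= tnth s i <= shift_nodes x i.+1).
      by move=> h1; apply: h; apply/iff.
    by rewrite mulr0 (bigD1 i)//= indicE memNset ?mul0r//= in_itv.
  by rewrite weight_out// !mulr0.
have [h1 h2] := iff.1 h.
rewrite weight_in// mulrA [RHS]mulrC; congr (_ * _); rewrite -big_split.
apply: eq_bigr => i _ /=; rewrite /gap_density indicE mem_set// mul1r.
by rewrite indicE mem_set ?mul1r//= ?in_itv/= ?h1// mulrC.
Qed.

Lemma cell_factor_ge0 x (s : Rtuple R n) : 0 <= cell_factor x s.
Proof. by apply: prodr_ge0 => i _; rewrite mulr_ge0// invr_ge0 powR_ge0. Qed.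

Lemma integral_jointE x (t : Rtuple R n) : Wint x -> Wtuple t ->
  (\int[leb R n]_s (joint x t s)%:E)%E =
    (vandermonde (vec t) * \prod_(i < n) \int[mu]_s gap_density x t i s)%:E.
Proof.
move=> Wx Wtt.
have gfin i : (\int[mu]_s (gap_density x t i s)%:E)%E \is a fin_num.
  rewrite ge0_fin_numE ?integral_gap_density_lty// integral_ge0// => s _.
  by rewrite lee_fin gap_density_ge0.
under eq_integral do rewrite -prod_gap_density// EFinM.
rewrite ge0_integralZl//.
- rewrite ge0_integral_leb_prod//.
  + rewrite EFinM; congr (_ * _)%E; rewrite -prodEFin; apply: eq_bigr => i _.
    by rewrite fineK.
  + by move=> i; exact: measurable_gap_density.
  + by move=> i s; exact: gap_density_ge0.
- apply/measurable_EFinP.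
  by apply: (@measurable_coords_prod _ _ (gap_density x t)) => i; exact: measurable_gap_density.
- by move=> s _; rewrite lee_fin prodr_ge0// => i _; exact: gap_density_ge0.
- rewrite lee_fin; apply: prodr_ge0 => i _; apply: prodr_ge0 => j ij.
  by rewrite subr_ge0; apply: Wtt.2; exact: ltnW.
Qed.

(** Integrating out s. If one gap is empty both sides vanish; otherwise the
    indicators in the density equal 1, because the coordinate k of t is above
    coordinate k - 1 of s, hence above that of x, and below coordinate k of s. *)
Lemma density_SNE x (t : Rtuple R n) : Wint x -> Wtuple t ->
  density_SN a x (vec t) = norm_SN x * poch (a + 1) n *
    fine (\int[leb R n]_s (joint x t s)%:E).
Proof.
move=> Wx Wtt; rewrite integral_jointE//.
rewrite /density_SN big_add1 big_mkord /=.
have -> : \prod_(i < n)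
   (\1_(`[coord x i, coord x i.+2]) (coord (vec t) i.+1) *
    \int[mu]_(z in `[Num.max (coord x i.+1) (coord (vec t) i.+1), upper_end x (vec t) i.+1])
       (coord (vec t) i.+1 `^ a / z `^ (a + 1))) =
   \prod_(i < n) \int[mu]_s gap_density x t i s.
  have E (i : 'I_n) :
     \int[mu]_(z in `[Num.max (coord x i.+1) (coord (vec t) i.+1), upper_end x (vec t) i.+1])
       (coord (vec t) i.+1 `^ a / z `^ (a + 1)) = \int[mu]_s gap_density x t i s.
    rewrite Rintegral_mkcond; apply: eq_Rintegral => s _.
    rewrite coord_vec patchE /gap_density indicE /gap.
    by case: ifP => _; rewrite ?mul1r ?mul0r.
  under eq_bigr do rewrite E.
  case: (pselect (forall i : 'I_n, exists s, gap x t i s)) => h.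
    apply: eq_bigr => i _.
    suff hi : coord x i <= tnth t i <= coord x i.+2.
      by rewrite coord_vec indicE (_ : _ \in _ = true) ?mul1r//; apply: mem_set.
    have [s /gapP[g1 g2 g3 g4]] := h i; rewrite (le_trans g3)// andbT.
    case: i {s g1 g2 g3 g4} => -[|k] kn; first exact: ((WtupleP t).1 Wtt).1.
    have [s /gapP[g1 _ _ /(_ kn) g4]] := h (Ordinal (ltnW kn)).
    by rewrite -(coord_vec t (Ordinal kn)); exact: le_trans g1 g4.
  have /existsNP[i hi] := h.
  have i0 : \int[mu]_s gap_density x t i s = 0.
    transitivity (\int[mu]_s (0 : R)); last by rewrite /Rintegral integral0.
    apply: eq_Rintegral => s _.
    by rewrite /gap_density indicE memNset ?mul0r// => hs; apply: hi; exists s.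
  by rewrite (bigD1 i)//= [in RHS](bigD1 i)//= i0 mulr0 !mul0r.
by rewrite /norm_SN -poch1 /=; ring.
Qed.

Lemma measurable_fun_indic_itv d (T : measurableType d) (u v w : T -> R) :
  measurable_fun setT u -> measurable_fun setT v -> measurable_fun setT w ->
  measurable_fun setT (fun q => \1_(`[u q, v q]) (w q) : R).
Proof.
move=> mu' mv mw.
have -> : (fun q => \1_(`[u q, v q]) (w q) : R) =
    \1_([set q | u q <= w q] `&` [set q | w q <= v q]).
  apply/funext => q; rewrite !indicE; congr ((nat_of_bool _)%:R); apply/idP/idP.
    by rewrite !inE/= in_itv/= => /andP[].
  by rewrite !inE/= in_itv/= => -[-> ->].
apply: measurable_indic; apply: measurableI.
  by rewrite -[X in measurable X]setTI; exact: measurable_fun_le.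
by rewrite -[X in measurable X]setTI; exact: measurable_fun_le.
Qed.

Lemma measurable_coord_vec k : measurable_fun [set: Rtuple R n] (fun s => coord (vec s) k).
Proof.
case: k => [|k] //; rewrite /coord; case: insubP => [i _ _|_] //=.
under eq_fun do rewrite mxE; exact: measurable_tnth.
Qed.

Lemma measurable_joint x :
  measurable_fun [set: Rtuple R n * Rtuple R n] (fun ts => joint x ts.1 ts.2).
Proof.
have mfst (i : 'I_n) : measurable_fun [set: Rtuple R n * Rtuple R n]
    (fun ts => tnth ts.1 i : R).
  by apply: (measurableT_comp (measurable_tnth i)); exact: measurable_fst.
have msnd (g : Rtuple R n -> R) : measurable_fun setT g ->
    measurable_fun [set: Rtuple R n * Rtuple R n] (fun ts => g ts.2).
  by move=> mg; apply: (measurableT_comp mg); exact: measurable_snd.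
have mfs (g : Rtuple R n -> R) : measurable_fun setT g ->
    measurable_fun [set: Rtuple R n * Rtuple R n] (fun ts => g ts.1).
  by move=> mg; apply: (measurableT_comp mg); exact: measurable_fst.
apply: measurable_funM.
  apply: (msnd (cell_factor x)); apply: (@measurable_coords_prod _ _ (fun i y =>
    \1_(`[shift_nodes x i, shift_nodes x i.+1]) y * (y `^ (a + 1))^-1)) => i.
  apply: measurable_funM; first exact: measurable_indic.
  exact: (measurableT_comp measurable_inv (measurable_powR _)).
apply: measurable_funM.
  by apply: (mfs (\1_(@Wtuple R n))); apply: measurable_indic; exact: measurable_Wtuple.
apply: measurable_funM; last by apply: (mfs (fun t => vandermonde (vec t))); exact: measurable_vandermonde.
apply: measurable_prod => i _; apply: measurable_funM.
  apply: measurable_fun_indic_itv => //.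
  - apply: (msnd (fun s => coord (vec s) i)); exact: measurable_coord_vec.
  - apply: (msnd (fun s => coord (vec s) i.+1)); exact: measurable_coord_vec.
exact: (measurableT_comp (measurable_powR _) (mfst i)).
Qed.

Lemma joint_ge0 x (t s : Rtuple R n) : 0 <= joint x t s.
Proof.
rewrite /joint; case: (boolP (t \in @Wtuple R n)) => [/[!inE] Wtt|nW].
  rewrite -[leRHS]/(joint x t s) -prod_gap_density// mulr_ge0//.
    apply: prodr_ge0 => i _; apply: prodr_ge0 => j ij.
    by rewrite subr_ge0; apply: Wtt.2; exact: ltnW.
  by apply: prodr_ge0 => i _; exact: gap_density_ge0.
by rewrite indicE (negbTE nW) mul0r mulr0.
Qed.

Variable x : 'rV[R]_n.+1.
Hypothesis Wx : Wint x.
Let p := shift_nodes x.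

Let in_box (s : Rtuple R n) := forall i : 'I_n, p i <= tnth s i <= p i.+1.

Let np : nodes n p. Proof. exact/nodes_coordS/Wint_W. Qed.

Let box_pos s : in_box s -> forall i, 0 < (tnth s i : R).
Proof.
move=> hs i; have /andP[+ _] := hs i; apply: lt_le_trans.
by rewrite /p /shift_nodes (@coordS _ _ x (widen_ord (leqnSn n) i)) Wx.1.
Qed.

Let box_W s : in_box s -> Wtuple s.
Proof.
move=> hs; apply/WtupleP; split=> [i|i j]; first exact/ltW/box_pos.
rewrite leq_eqVlt => /predU1P[/val_inj ->//|ij].
have /andP[_ h1] := hs i; have /andP[h2 _] := hs j.
by rewrite (le_trans h1)// (le_trans _ h2)// (nodes_le np)// ltnW.
Qed.

Let factor_out s : ~ in_box s -> cell_factor x s = 0.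
Proof.
move=> /existsNP[i hi].
by rewrite /cell_factor (bigD1 i)//= indicE memNset ?mul0r//= in_itv.
Qed.

Let factor_in s : in_box s ->
  cell_factor x s = (\prod_(i < n) (vec s) ord0 i `^ (a + 1))^-1.
Proof.
move=> hs; rewrite /cell_factor -prodfV; apply: eq_bigr => i _.
by rewrite indicE mem_set ?mul1r ?mxE//= in_itv/= hs.
Qed.

Let weight0_in s : in_box s -> weight 0 p s = vandermonde (vec s).
Proof.
by move=> hs; rewrite weight_in// big1 ?mul1r// => i _; rewrite powRr0.
Qed.

(* s need only lie in the closed box: both sides vanish when coordinates of s
   coincide *)
Let cell_mass s : in_box s ->
  cell_factor x s * cell_integral a (coord (vec s)) (fun _ : Rtuple R n => 1) =
  (poch (a + 1) n)^-1 * weight 0 p s.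
Proof.
move=> hs; rewrite weight0_in//.
have -> : (fun _ : Rtuple R n => 1) = @decay R (a + n%:R + 1) 0 n.
  by apply/funext => t; rewrite decay0.
rewrite /cell_integral integral_weight_decay_NN//; last exact/nodes_coord/box_W.
rewrite [X in _ * (_ * X)]big1 ?mulr1; last first.
  by move=> i _; rewrite mul0r addr0 powR1.
rewrite factor_in//.
have -> : \prod_(i < n) coord (vec s) i.+1 `^ (a + 1) =
    \prod_(i < n) (vec s) ord0 i `^ (a + 1).
  by apply: eq_bigr => i _; rewrite coordS.
have -> : \prod_(i < n) \prod_(j < n | (i < j)%N)
    (coord (vec s) j.+1 - coord (vec s) i.+1) = vandermonde (vec s).
  by apply: eq_bigr => i _; apply: eq_bigr => j _; rewrite !coordS.
have h : \prod_(i < n) (vec s) ord0 i `^ (a + 1) != 0.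
  by rewrite lt0r_neq0// prodr_gt0// => i _; rewrite powR_gt0// mxE box_pos.
have h2 := lt0r_neq0 (@poch_gt0 R (a + 1) n ltac:(move: a1; lra)).
by field; rewrite h h2.
Qed.

Variable L : 'rV[R]_n -> {measure set (Rtuple R n) -> \bar R}.
Hypothesis LP : is_Lambda_NN a L.
Variable f : 'rV[R]_n -> R.
Hypothesis Cf : C_infty (@W R n) f.

Let box_Wint s : in_box s -> vandermonde (vec s) != 0 -> Wint (vec s).
Proof.
move=> hs V0; split=> [i|i j ij]; first by rewrite mxE box_pos.
rewrite lt_neqAle (box_W hs).2 1?ltnW// andbT; apply/eqP => e.
move/negP : V0; apply; rewrite /vandermonde prodf_seq_eq0/=.
apply/hasP; exists i; first exact: mem_index_enum.
rewrite prodf_seq_eq0/=; apply/hasP; exists j; first exact: mem_index_enum.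
by rewrite ij e subrr/=.
Qed.

Let inner s :
  cell_factor x s * cell_integral a (coord (vec s)) (ext f) =
  (poch (a + 1) n)^-1 * (weight 0 p s * ext (kernel_op L f) s).
Proof.
have [B B0 fB] := C_infty_bound Cf.
case: (pselect (in_box s)) => hs; last first.
  by rewrite factor_out// weight_out// !mul0r mulr0.
(* if two coordinates of s coincide then s is not an interior point, but the
   cell between them is degenerate and both sides are 0 *)
have [V0|V0] := eqVneq (vandermonde (vec s)) 0.
  have m0 := cell_mass hs; rewrite weight0_in// V0 mulr0 in m0.
  rewrite weight0_in// V0 mul0r mulr0; apply/eqP.
  rewrite -normr_le0 normrM (ger0_norm (cell_factor_ge0 _ _)).
  apply: (@le_trans _ _ (cell_factor x s *
      (B * cell_integral a (coord (vec s)) (fun _ : Rtuple R n => 1)))).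
    rewrite ler_wpM2l ?cell_factor_ge0//; apply: cell_integral_bound => //.
    - exact/nodes_coord/box_W.
    - exact: measurable_ext.
    - exact: ext_bound.
  by rewrite mulrCA m0 mulr0.
have Ws := box_Wint hs V0.
rewrite ext_W; last exact: box_W.
rewrite (kernel_NN a1 LP Cf Ws) weight0_in// factor_in// /norm_NN.
have h : \prod_(i < n) (vec s) ord0 i `^ (a + 1) != 0.
  by rewrite lt0r_neq0// prodr_gt0// => i _; rewrite powR_gt0// mxE box_pos.
have h2 := lt0r_neq0 (@poch_gt0 R (a + 1) n ltac:(move: a1; lra)).
by field; rewrite h h2 V0.
Qed.

Let F (ts : Rtuple R n * Rtuple R n) : \bar R := (joint x ts.1 ts.2 * ext f ts.1)%:E.

Let mF : measurable_fun setT F.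
Proof.
apply/measurable_EFinP; apply: measurable_funM; first exact: measurable_joint.
apply: (measurableT_comp (measurable_ext Cf)); exact: measurable_fst.
Qed.

Let joint_int s : (\int[leb R n]_t (joint x t s)%:E <=
  ((poch (a + 1) n)^-1 * weight 0 p s)%:E)%E.
Proof.
case: (pselect (in_box s)) => hs; last first.
  under eq_integral do rewrite /joint factor_out// mul0r.
  by rewrite integral0 weight_out// mulr0.
rewrite -cell_mass//.
have ns : nodes n (coord (vec s)) by exact/nodes_coord/box_W.
have i1 := integrable_weight a1 ns.
rewrite /cell_integral; under [in leRHS]eq_Rintegral do rewrite mulr1.
rewrite /Rintegral EFinM fineK; last exact: integrable_fin_num.
rewrite -ge0_integralZl//; last 3 first.
- by apply/measurable_EFinP; exact: measurable_weight.
- by move=> t _; rewrite lee_fin weight_ge0.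
- by rewrite lee_fin cell_factor_ge0.
apply: ge0_le_integral => //.
- by move=> t _; rewrite lee_fin joint_ge0.
- apply/measurable_EFinP.
  exact: (measurableT_comp (measurable_joint x) (pair2_measurable s)).
- by apply/measurable_EFinP; apply: measurable_funM => //; exact: measurable_weight.
move=> t _; rewrite -EFinM lee_fin ler_wpM2l ?cell_factor_ge0//.
by rewrite indicE; case: (_ \in _); rewrite ?mul1r// mul0r weight_ge0.
Qed.

Let intF : (@leb_sigma R n \x @leb_sigma R n)%E.-integrable setT F.
Proof.
have [B B0 fB] := C_infty_bound Cf.
apply/integrable21ltyP => //.
have i0 := integrable_weight (ltac:(lra) : -1 < 0 :> R) np.
apply: (@le_lt_trans _ _ (\int[leb R n]_s (B * (poch (a + 1) n)^-1 * weight 0 p s)%:E)%E);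
    last first.
  have := integrableZl measurableT (B * (poch (a + 1) n)^-1) i0.
  by move=> /(integrable_lty measurableT).
have c0 : 0 <= (poch (a + 1) n)^-1.
  by rewrite invr_ge0 ltW// poch_gt0//; move: a1; lra.
apply: ge0_le_integral => //.
- by move=> s _; apply: integral_ge0 => t _.
- apply: (@measurable_fun_fubini_tonelli_G _ _ _ _ R (@leb_sigma R n) (abse \o F)).
    exact: measurableT_comp.
  by move=> ts; exact: abse_ge0.
- by apply/measurable_EFinP; apply: measurable_funM => //; exact: measurable_weight.
move=> s _; rewrite -mulrA EFinM.
have mj : measurable_fun setT (fun t => (joint x t s)%:E).
  apply/measurable_EFinP.
  exact: (measurableT_comp (measurable_joint x) (pair2_measurable s)).
apply: (@le_trans _ _ (B%:E * \int[leb R n]_t (joint x t s)%:E)%E); last first.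
  by apply: lee_wpmul2l; [rewrite lee_fin|exact: joint_int].
rewrite -ge0_integralZl//; last by move=> t _; rewrite lee_fin joint_ge0.
apply: ge0_le_integral => //.
- apply: measurableT_comp => //; exact: (measurableT_comp mF (pair2_measurable s)).
- exact: emeasurable_funM.
move=> t _; rewrite /F/= -EFinM lee_fin normrM mulrC.
by rewrite (ger0_norm (joint_ge0 _ _ _)) ler_wpM2r ?joint_ge0// ext_bound.
Qed.

Let k (t : Rtuple R n) := fine (\int[leb R n]_s (joint x t s)%:E)%E.

Let kE t : (\int[leb R n]_s (joint x t s)%:E)%E = (k t)%:E.
Proof.
rewrite /k fineK//; case: (pselect (Wtuple t)) => Wtt; first by rewrite integral_jointE.
under eq_integral do rewrite /joint indicE memNset// mul0r mulr0.
by rewrite integral0.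
Qed.

Let mk : measurable_fun setT k.
Proof.
apply/measurable_EFinP; rewrite (_ : _ \o _ =
    fubini_F (@leb_sigma R n) (fun ts => (joint x ts.1 ts.2)%:E)).
  apply: measurable_fun_fubini_tonelli_F.
    by apply/measurable_EFinP; exact: measurable_joint.
  by move=> ts; rewrite lee_fin joint_ge0.
by apply/funext => t; rewrite /fubini_F kE.
Qed.

Let k0 t : 0 <= k t.
Proof. by rewrite /k fine_ge0// integral_ge0// => s _; rewrite lee_fin joint_ge0. Qed.

Let kextE t : (\int[leb R n]_s F (t, s))%E = (k t * ext f t)%:E.
Proof.
have ij : (leb R n).-integrable setT (fun s => (joint x t s)%:E).
  apply/integrableP; split.
    apply/measurable_EFinP.
    exact: (measurableT_comp (measurable_joint x) (pair1_measurable t)).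
  under eq_integral do rewrite gee0_abs ?lee_fin ?joint_ge0//.
  by rewrite kE ltry.
rewrite /F/=; under eq_integral do rewrite EFinM.
by rewrite integralZr// kE.
Qed.

Let intk : (leb R n).-integrable setT (EFin \o (fun t => k t * ext f t)).
Proof.
have := integrable_fubini_F intF.
by rewrite (_ : fubini_F _ _ = EFin \o (fun t => k t * ext f t))//; apply/funext => t; rewrite /fubini_F kextE.
Qed.

Let cellE s : (\int[leb R n]_t F (t, s))%E =
  ((poch (a + 1) n)^-1 * (weight 0 p s * ext (kernel_op L f) s))%:E.
Proof.
rewrite -inner.
have [B B0 fB] := C_infty_bound Cf.
transitivity (\int[leb R n]_t ((cell_factor x s)%:E *
    (weight a (coord (vec s)) t * ext f t)%:E))%E.
  apply: eq_integral => t _; rewrite /F /joint/= -EFinM; congr (_%:E).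
  rewrite -mulrA; congr (_ * _); rewrite indicE /ext patchE.
  by case: ifPn => _; rewrite ?mul1r// !mulr0.
case: (pselect (in_box s)) => hs; last first.
  by rewrite factor_out// mul0r; under eq_integral do rewrite mul0e; rewrite integral0.
have ns : nodes n (coord (vec s)) by exact/nodes_coord/box_W.
have i1 := integrable_weightM a1 ns (measurable_ext Cf) (ext_bound B0 fB).
rewrite integralZl// EFinM; congr (_ * _)%E.
by rewrite /cell_integral /Rintegral fineK//; exact: integrable_fin_num.
Qed.

(** Fubini's theorem for [joint]: integrating t first gives the kernel of equal
    dimensions at s, and then s is integrated with the weight of exponent 0. *)
Lemma integral_SN (L' : 'rV[R]_n.+1 -> {measure set (Rtuple R n) -> \bar R}) :
  is_Lambda_SN a L' ->
  (\int[L' x]_(t in @Wtuple R n) (f (vec t))%:E =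
   (norm_SN x * cell_integral 0 p (ext (kernel_op L f)))%:E)%E.
Proof.
move=> L'P; pose c := norm_SN x * poch (a + 1) n.
have poch0 : 0 < poch (a + 1) n by apply: poch_gt0; move: a1; lra.
have c0 : 0 <= c by apply/ltW; rewrite mulr_gt0// norm_SN_gt0.
have CF : C_infty (@W R n) (kernel_op L f) by exact: (C_infty_NN a1 n0 LP Cf).
have [B B0 FB] := C_infty_bound CF.
rewrite (@integral_kernel_density _ n (L' x) (fun t => c * k t))//; last 4 first.
- exact: measurable_funM.
- by move=> t; rewrite mulr_ge0.
- move=> A mA; rewrite L'P.1//; apply: eq_integral => t; rewrite inE => -[_ Wtt].
  by rewrite density_SNE.
- under eq_fun do rewrite -mulrA.
  exact: (integrableZl measurableT c intk).
congr (_%:E); under eq_Rintegral do rewrite -mulrA.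
rewrite RintegralZl//.
rewrite /c -mulrA; congr (_ * _).
transitivity (poch (a + 1) n * ((poch (a + 1) n)^-1 *
    cell_integral 0 p (ext (kernel_op L f)))); last first.
  by rewrite mulVKf// lt0r_neq0.
congr (_ * _).
have intF0 : (leb R n).-integrable setT
    (EFin \o (fun t => weight 0 p t * ext (kernel_op L f) t)).
  apply: (integrable_weightM _ np (measurable_ext CF) (ext_bound B0 FB)); lra.
rewrite /cell_integral -RintegralZl//.
rewrite /Rintegral; congr fine.
under eq_integral do rewrite -kextE.
under [RHS]eq_integral do rewrite -cellE.
exact: (Fubini intF).
Qed.

End lowered_dimension.

Section lowered_dimension_operator.
Context {R : realType}.
Variables (a : R) (n : nat).
Hypotheses (a1 : -1 < a) (n0 : (0 < n)%N).
Variable L : 'rV[R]_n -> {measure set (Rtuple R n) -> \bar R}.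
Hypothesis LP : is_Lambda_NN a L.
Variable L' : 'rV[R]_n.+1 -> {measure set (Rtuple R n) -> \bar R}.
Hypothesis L'P : is_Lambda_SN a L'.

Lemma C_infty_SN (f : 'rV[R]_n -> R) : C_infty (@W R n) f ->
  C_infty (@W R n.+1) (kernel_op L' f).
Proof.
move=> Cf; have CF := C_infty_NN a1 n0 LP Cf.
have [B B0 FB] := C_infty_bound CF.
have kSN x : Wint x ->
    kernel_op L' f x = norm_SN x * cell_integral 0 (shift_nodes x) (ext (kernel_op L f)).
  by move=> Wx; rewrite /kernel_op /Rintegral (integral_SN a1 n0 Wx LP Cf L'P).
have a0 : -1 < 0 :> R by lra.
have r0 : 0 < n%:R :> R by rewrite ltr0n.
have Z0 (x : 'rV[R]_n.+1) : Wint x -> 0 <= norm_SN x by move=> Wx; exact/ltW/norm_SN_gt0.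
have nx (x : 'rV[R]_n.+1) : Wint x -> nodes n (shift_nodes x).
  by move=> Wx; exact/nodes_coordS/Wint_W.
apply: (@kernel_C_infty R 0 n n.+1 (@shift_nodes R n) (@norm_SN R n) n%:R
    a0 r0 nx _ Z0 _ _ (kernel_op L f)) => //.
- by move=> x u Wx ux i _; exact: cvg_coord.
- exact: norm_SN_cvg.
- exact: norm_SN_decay.
apply: (@weak_extension_cvg _ _ _ _ L' f B L'P Cf) => x Wx.
  by rewrite (integral_SN a1 n0 Wx LP Cf L'P) kSN.
rewrite kSN//.
apply: (@kernel_bound R 0 n n.+1 (@shift_nodes R n) (@norm_SN R n) n%:R) => //.
- exact: norm_SN_decay.
- exact: measurable_ext.
- exact: ext_bound.
Qed.

End lowered_dimension_operator.

Theorem proposition2p5 (R : realType) (alpha : R) (N : nat)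
    (alpha_gt : -1 < alpha) (N_gt0 : (0 < N)%N)
    (Lambda_NN : 'rV[R]_N -> {measure set (Rtuple R N) -> \bar R})
    (Lambda_SN : 'rV[R]_N.+1 -> {measure set (Rtuple R N) -> \bar R})
    (Lambda_NN_def : is_Lambda_NN alpha Lambda_NN)
    (Lambda_SN_def : is_Lambda_SN alpha Lambda_SN) :
  (forall f : 'rV[R]_N -> R, C_infty (@W R N) f ->
     C_infty (@W R N) (kernel_op Lambda_NN f)) /\
  (forall f : 'rV[R]_N -> R, C_infty (@W R N) f ->
     C_infty (@W R N.+1) (kernel_op Lambda_SN f)).
Proof.
split=> f Cf; first exact: (C_infty_NN alpha_gt N_gt0 Lambda_NN_def Cf).
exact: (C_infty_SN alpha_gt N_gt0 Lambda_NN_def Lambda_SN_def Cf).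
Qed.
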